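(* For integers $d,k$ with $2\le k\le d-1$ we have $$\underline{sa}_d^s(d+k) = \Theta\left((d-k)d\right).$$ Moreover, the quotient $U(d,k)/L(d,k)$ of the upper estimate $$U(d,k):=\begin{cases}\dfrac{d(d+1)}{2}+k-1, & 2\le k\le\lfloor (2d-2)/3\rfloor,\\[2mm] k+\dfrac{(d-k)(d+3k-1)}{2}, & \lceil (2d-2)/3\rceil\le k\le d-1,\end{cases}$$ of $\underline{sa}_d^s(d+k)$ and of the lower estimate $$L(d,k):=\frac{d^2-k^2+d+k}{2}$$ of $\underline{sa}_d^s(d+k)$ is at most $2$, and this value $2$ is sharp (it cannot be replaced by any smaller constant valid for all such $d,k$).
   Context: Let $X=\{x_1,\dots,x_n\}\subset\mathbb{R}^d$ be a finite set (with $x_i\neq x_j$ for $i\ne j$) whose affine hull is $\mathbb{R}^d$, and let $P=\operatorname{conv}X$. Two distinct points $x_i,x_j\in X$ are strictly antipodal (in $X$) if there are different parallel supporting hyperplanes $H',H''$ of $P$ with $X\cap H'=\{x_i\}$ and $X\cap H''=\{x_j\}$. $sa(X)$ is the number of (unordered) strictly antipodal pairs of $X$. $X$ is in strictly convex position if $X=\operatorname{vert}P$ (the vertex set of $P$). $\mathcal{C}_d^s(n)$ is the family of all $X\subset\mathbb{R}^d$ with $|X|=n$, $\operatorname{aff}X=\mathbb{R}^d$, $X$ in strictly convex position, and $\underline{sa}_d^s(n):=\min\{sa(X)\mid X\in\mathcal{C}_d^s(n)\}$. The $\Theta(\cdot)$ relation means two-sided bounds with positive absolute constants, over the stated range of $d,k$.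 If $(2d-2)/3$ is an integer, both lines in the definition of $U(d,k)$ give the same value at $k=(2d-2)/3$. *)

(* Defs.v *)
(* Points of R^d are row vectors 'rV[R]_d over an abstract R : realType. *)
From HB Require Import structures.
From mathcomp Require Import all_boot all_order all_algebra finmap.
From mathcomp Require Import boolp classical_sets reals convex.

Set Implicit Arguments.
Unset Strict Implicit.
Unset Printing Implicit Defensive.

Import Order.TTheory GRing.Theory Num.Theory.

Local Open Scope classical_set_scope.
Local Open Scope ring_scope.

Section Polytopes.
Variables (R : realType) (d : nat).
Local Notation V := 'rV[R]_d.
Implicit Types (A H P : set V) (u v x y : V) (b : R).

Definition dotv u v : R := \sum_(i < d) u 0 i * v 0 i.

Definition conv_hull A : set V :=
  smallest (fun B : set (convex_lmodType V) => convex_set B) A.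

Definition affine_set A : Prop :=
  forall x y (t : R), A x -> A y -> A (t *: x + (1 - t) *: y).

Definition aff_hull A : set V := smallest affine_set A.

Definition hyperplane u b : set V := [set x | dotv u x = b].

(* Replacing (u, b) by (- u, - b) covers the case where P lies on the other
   side of H. *)
Definition supporting_hyperplane P H : Prop :=
  exists u b, [/\ u != 0, H = hyperplane u b,
    (forall x, P x -> dotv u x <= b) & P `&` H !=set0].

Definition parallel_hyperplanes H H' : Prop :=
  exists u b b', [/\ u != 0, H = hyperplane u b & H' = hyperplane u b'].

(* The vertices of P are its faces of dimension 0; a face is cut out by a valid
   inequality dotv u x <= b, and u = 0 only contributes P itself and set0. *)
Definition vert P : set V :=
  [set v | exists u b, (forall x, P x -> dotv u x <= b) /\
                       P `&` [set x | dotv u x = b] = [set v]].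

Implicit Types X : {fset V}.

Definition polytope X : set V := conv_hull [set` X].

Definition strictly_antipodal X x y : Prop :=
  [/\ x \in X, y \in X, x <> y &
    exists H' H'', [/\ supporting_hyperplane (polytope X) H',
                       supporting_hyperplane (polytope X) H'',
                       parallel_hyperplanes H' H'' /\ H' <> H'',
                       [set` X] `&` H' = [set x] &
                       [set` X] `&` H'' = [set y]]].

Definition sa X : nat :=
  #|` [fset e in fpowerset X
        | `[< exists x y, e = [fset x; y]%fset /\ strictly_antipodal X x y >]]%fset |.

Definition strictly_convex_position X : Prop := [set` X] = vert (polytope X).

Definition Cs (n : nat) : set {fset V} :=
  [set X | [/\ #|` X| = n, aff_hull [set` X] = [set: V]
             & strictly_convex_position X]].

(* The value is 0 by default when Cs n is empty. *)
Definition sa_min (n : nat) : nat :=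
  xget 0%N [set m | (exists2 X, Cs n X & sa X = m) /\
                    (forall X, Cs n X -> (m <= sa X)%N)].

End Polytopes.

Arguments sa_min R d n : clear implicits.

Section Estimates.
Variable R : realType.

Definition U_est (d k : nat) : R :=
  if (k <= (2 * d - 2) %/ 3)%N
  then d%:R * (d%:R + 1) / 2 + k%:R - 1
  else k%:R + (d%:R - k%:R) * (d%:R + 3 * k%:R - 1) / 2.

Definition L_est (d k : nat) : R :=
  (d%:R ^+ 2 - k%:R ^+ 2 + d%:R + k%:R) / 2.

End Estimates.

Arguments U_est R d k : clear implicits.
Arguments L_est R d k : clear implicits.

(* Main.v *)
Require Import Defs.
From HB Require Import structures.
From mathcomp Require Import all_boot all_order all_algebra finmap.
From mathcomp Require Import boolp classical_sets reals convex.
From mathcomp Require Import interval_inference zify ring lra.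

Import Order.TTheory GRing.Theory Num.Theory.

Local Open Scope ring_scope.

Set Implicit Arguments.
Unset Strict Implicit.
Unset Printing Implicit Defensive.

(* Lower bound. Represent X by the space W of restrictions to X of the affine
   functionals, and induct on D = \rank W = d + 1, showing
   D (D - 1) <= N + K (K - 1), where N is the number of ordered strictly
   antipodal pairs and K = |X| + 1 - D; this is sa >= C(d + 1, 2) - C(k, 2).
   Let F be a facet and F1 the opposite face. If F1 is a single point p, then p
   is strictly antipodal to every point of F; project along the line through p
   and the barycenter of F: p is no longer a vertex, so no pair at p is
   counted again. Otherwise project along the linear hull of F1, so that F1
   becomes one vertex: each of the v vertices of the projection of F is then
   antipodal to that vertex, and lifts to |F1| pairs of X instead of one.
   A projection is a subspace V of W; the vertices of the image are the classes
   of points not separated by V that are the maximum set of some functional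
   of V, and every strictly antipodal pair of the image lifts to X.

   Upper bound. For small k, take a simplex 0, e_1, ..., e_d and k - 1 points
   (1 + e_s) / d just beyond the facet e_1, ..., e_d; the only new pairs join
   these points to 0. For large k, take e_1, ..., e_d, - e_1, ..., - e_k. *)

(** * Maximum sets of functions *)

Section ArgMax.
Variables (R : realFieldType) (n : nat).
Implicit Types (A B : {set 'I_n}) (f g : 'rV[R]_n) (i j : 'I_n).

Definition argmax A f : {set 'I_n} :=
  [set i in A | [forall z in A, f 0 z <= f 0 i]].

Lemma argmaxP A f i :
  reflect (i \in A /\ forall z, z \in A -> f 0 z <= f 0 i) (i \in argmax A f).
Proof.
rewrite inE; apply: (iffP andP) => -[iA h]; split=> //.
  by move=> z zA; exact: (forall_inP h).
exact/forall_inP.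
Qed.

Lemma argmaxW A f i : i \in argmax A f -> i \in A.
Proof. by case/argmaxP. Qed.

Lemma argmax_neq0 A f i : i \in A -> exists j, j \in argmax A f.
Proof.
move=> iA; case: (Order.TotalTheory.arg_maxP (f 0) iA) => j jA jmax.
by exists j; apply/argmaxP.
Qed.

Lemma argmax_eq A f i j : i \in argmax A f -> j \in argmax A f -> f 0 i = f 0 j.
Proof.
by move=> /argmaxP[iA hi] /argmaxP[jA hj]; apply/le_anti; rewrite hj // hi.
Qed.

Lemma argmax_max A f i j :
  i \in argmax A f -> j \in A -> f 0 i <= f 0 j -> j \in argmax A f.
Proof.
move=> /argmaxP[_ hi] jA ij; apply/argmaxP; split=> // z /hi zi.
exact: le_trans ij.
Qed.

Lemma argmax_set1 A f i :
  argmax A f = [set i] -> forall z, z \in A -> z != i -> f 0 z < f 0 i.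
Proof.
move=> h z zA zi; have : i \in argmax A f by rewrite h set11.
move=> iM; have [_ /(_ z zA)] := argmaxP _ _ _ iM.
rewrite le_eqVlt => /predU1P[zi0|//].
have : z \in argmax A f by apply: argmax_max iM zA _; rewrite zi0.
by rewrite h inE (negPf zi).
Qed.

Lemma set1_argmax A f i :
  i \in A -> (forall z, z \in A -> z != i -> f 0 z < f 0 i) -> argmax A f = [set i].
Proof.
move=> iA h; apply/setP => z; rewrite [RHS]inE; apply/argmaxP/eqP => [[zA hz]|->].
  apply/eqP/contraT => /(h _ zA); rewrite ltNge hz //.
split=> // z' z'A; have [->//|/(h _ z'A)/ltW//] := eqVneq z' i.
Qed.

Lemma argmax_sub1 A B f i :
  B \subset A -> i \in B -> argmax A f = [set i] -> argmax B f = [set i].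
Proof.
move=> /fintype.subsetP BA iB /argmax_set1 h.
by apply: set1_argmax => // z /BA; exact: h.
Qed.

Lemma argmax1 i f : argmax [set i] f = [set i].
Proof. by apply: set1_argmax; rewrite ?set11 // => z /set1P ->; rewrite eqxx. Qed.

Lemma small_all (T : finType) (P : T -> R -> Prop) :
  (forall t, exists2 e0, 0 < e0 & forall e, 0 < e <= e0 -> P t e) ->
  exists2 e0, 0 < e0 & forall e, 0 < e <= e0 -> forall t, P t e.
Proof.
move=> /fin_all_exists2[e0 e0_gt0 h].
exists (\big[Num.min/1]_t e0 t).
  by apply: lt_bigmin => //; exact: ltr01.
move=> e /andP[e_gt0 le_e] t; apply: h; rewrite e_gt0 (le_trans le_e) //.
exact: bigmin_le.
Qed.

(** A small perturbation maximizes lexicographically: strict inequalities between values of [f]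
    survive, so [g] only decides among the maxima of [f]. *)
Lemma argmax_perturb A f g :
  exists2 e0, 0 < e0 & forall e, 0 < e <= e0 ->
    argmax A (f + e *: g) = argmax (argmax A f) g.
Proof.
pose P (p : 'I_n * 'I_n) (e : R) :=
  f 0 p.1 < f 0 p.2 -> f 0 p.1 + e * g 0 p.1 < f 0 p.2 + e * g 0 p.2.
have [|e0 e0_gt0 he0] := @small_all _ P.
  move=> [i j]; rewrite /P /=; have [lt_ij|?] := ltP (f 0 i) (f 0 j); last first.
    by exists 1.
  (* The summand 1 makes [c] a positive strict bound on the variation of [g], so
     [e * c <= f 0 j - f 0 i] keeps the inequality strict. *)
  set c := `|g 0 i - g 0 j| + 1.
  have c_gt0 : 0 < c by rewrite ltr_wpDl.
  exists ((f 0 j - f 0 i) / c); first by rewrite divr_gt0 // subr_gt0.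
  move=> e /andP[e_gt0]; rewrite ler_pdivlMr // => ec _.
  have : e * (g 0 i - g 0 j) < e * c.
    by rewrite ltr_pM2l // /c ltr_pwDr // ler_norm.
  by lra.
exists e0 => // e ee0; have /andP[e_gt0 _] := ee0.
move: ee0 => /he0 {}he0; apply/setP => i.
have E z : (f + e *: g) 0 z = f 0 z + e * g 0 z by rewrite !mxE.
apply/argmaxP/argmaxP => [[iA hi]|[iM hi]].
  have iM : i \in argmax A f.
    apply/argmaxP; split=> // z zA; rewrite leNgt; apply/negP => /(he0 (i, z)) /=.
    by rewrite ltNge -!E hi.
  split=> // z zM; have := hi z (argmaxW zM).
  by rewrite !E (argmax_eq zM iM) lerD2l ler_pM2l.
have [iA hiA] := argmaxP _ _ _ iM.
split=> // z zA; rewrite !E.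
have [lt_zi|] := ltP (f 0 z) (f 0 i); first exact/ltW/(he0 (z, i)).
move=> /(argmax_max iM zA) zM; rewrite (argmax_eq zM iM) lerD2l ler_pM2l //.
exact: hi.
Qed.
End ArgMax.

(** * Configurations and their projections *)

Section Configurations.
Variables (R : realFieldType) (n : nat).
Implicit Types (A B : {set 'I_n}) (f g : 'rV[R]_n) (i j : 'I_n) (W V : 'M[R]_n).

Lemma perturb A f g : exists2 e, 0 < e &
  argmax A (f + e *: g) = argmax (argmax A f) g /\
  argmax A (- (f + e *: g)) = argmax (argmax A (- f)) (- g).
Proof.
have [e1 e1_gt0 h1] := argmax_perturb A f g.
have [e2 e2_gt0 h2] := argmax_perturb A (- f) (- g).
exists (Num.min e1 e2); first by rewrite lt_min e1_gt0.
rewrite opprD -scalerN h1 ?h2 // lt_min e1_gt0 e2_gt0 ge_min lexx ?orbT //.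
Qed.

Lemma oppmx_sub m f (W : 'M[R]_(m, n)) : (f <= W)%MS -> (- f <= W)%MS.
Proof. by move=> fW; rewrite -scaleN1r scalemx_sub. Qed.

(** The row space of [W] plays the affine functionals, so [\rank W] is the dimension plus one.
    Entries outside [A] are carried along; by the second clause those on [A] determine them. The
    third makes each point a vertex. *)
Definition config A W : Prop :=
  [/\ ((const_mx 1 : 'rV[R]_n) <= W)%MS,
      forall f, (f <= W)%MS -> (forall i, i \in A -> f 0 i = 0) -> f = 0 &
      forall i, i \in A -> exists2 f, (f <= W)%MS & argmax A f = [set i]].

(** Pairs are ordered, and [i = j] occurs exactly when [A] is a singleton. *)
Definition antipodal A W i j : Prop :=
  exists f, [/\ (f <= W)%MS, argmax A f = [set i] & argmax A (- f) = [set j]].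

Definition antipodal_set A W : {set 'I_n * 'I_n} :=
  [set p | `[< antipodal A W p.1 p.2 >]].

Lemma antipodal_sym A W i j : antipodal A W i j -> antipodal A W j i.
Proof. by case=> f [fW fi fj]; exists (- f); rewrite opprK oppmx_sub. Qed.

Lemma antipodal_in A W i j : antipodal A W i j -> i \in A /\ j \in A.
Proof.
case=> f [_ fi fj]; split.
  by apply: (@argmaxW _ _ _ f); rewrite fi set11.
by apply: (@argmaxW _ _ _ (- f)); rewrite fj set11.
Qed.

(** Perturb [f] towards a functional exposing [i], then against one exposing a point [j] of the new
    bottom face; the second step leaves the top face [[set i]] alone. *)
Lemma exists_antipodal A W f i : config A W -> (f <= W)%MS ->
  i \in argmax A f -> exists2 j, j \in argmax A (- f) & antipodal A W i j.
Proof.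
move=> [_ _ vertW] fW iM; have iA := argmaxW iM.
have [g gW gi] := vertW i iA.
have [e e_gt0 [fgM fgm]] := perturb A f g.
have [j jm] := argmax_neq0 (- (f + e *: g)) iA.
have jA := argmaxW jm; rewrite fgm in jm.
have [h hW hj] := vertW j jA.
have [e' e'_gt0 [fghM fghm]] := perturb A (f + e *: g) (- h).
exists j; first exact: argmaxW jm.
exists (f + e *: g + e' *: - h); split.
- by rewrite !addmx_sub ?scalemx_sub // -scaleN1r scalemx_sub.
- rewrite fghM fgM (@argmax_sub1 _ _ A (argmax A f) g i) ?argmax1 //.
  by apply/fintype.subsetP => z /argmaxW.
- rewrite fghm fgm opprK (@argmax_sub1 _ _ A _ h j) //.
  by apply/fintype.subsetP => z /argmaxW /argmaxW.
Qed.

(** * Projections: classes of points and vertices of the image *)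

Section Reduction.
Variables (A : {set 'I_n}) (V : 'M[R]_n).

(** Rows of [V] span the functionals, so equal columns mean that the projection dual to [V]
    identifies the two points. *)
Definition same i j := col i V == col j V.

Lemma same_eqP i j : reflect (forall f, (f <= V)%MS -> f 0 i = f 0 j) (same i j).
Proof.
apply: (iffP eqP) => [E f /submxP[D ->]|h].
  have := congr1 (fun C => (D *m C) 0 0) E.
  by rewrite !mxE; under eq_bigr do rewrite mxE; under [RHS]eq_bigr do rewrite mxE.
by apply/colP => r; have := h (row r V) (row_sub _ _); rewrite !mxE.
Qed.

Lemma samexx i : same i i. Proof. exact: eqxx. Qed.
Lemma same_sym i j : same i j = same j i. Proof. exact: eq_sym. Qed.
Lemma same_trans i j k : same i j -> same j k -> same i k.
Proof. by rewrite /same => /eqP -> /eqP ->. Qed.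

Lemma not_same i j : ~~ same i j -> exists2 f : 'rV[R]_n, (f <= V)%MS & f 0 i < f 0 j.
Proof.
move=> /same_eqP; apply: contra_notP => h f fV.
apply/eqP; rewrite eq_le; apply/andP; split; rewrite leNgt; apply/negP => lt; apply: h.
  by exists (- f); rewrite ?mxE ?ltrN2 // -scaleN1r scalemx_sub.
by exists f.
Qed.

Definition class i : {set 'I_n} := [set j in A | same j i].
(** [pick] depends only on the class, so the choice is canonical; the default [i] is never taken for
    [i] in [A]. *)
Definition class_rep i := odflt i [pick j in A | same j i].

Lemma class_repP i : i \in A -> class_rep i \in A /\ same (class_rep i) i.
Proof.
move=> iA; rewrite /class_rep; case: pickP => [j /andP[]//|/(_ i)].
by rewrite iA samexx.
Qed.

Lemma eq_class_rep i j : i \in A -> same i j -> class_rep i = class_rep j.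
Proof.
move=> iA ij; rewrite /class_rep (@eq_pick _ _ [pred z in A | same z j]).
  by case: pickP => // /(_ i); rewrite /= iA ij.
by move=> z /=; rewrite /same (eqP ij).
Qed.

Definition class_reps : {set 'I_n} :=
  [set i in A | (class_rep i == i) && `[< exists2 f, (f <= V)%MS & argmax A f = class i >]].

Lemma class_repsP i : i \in class_reps ->
  [/\ i \in A, class_rep i = i & exists2 f, (f <= V)%MS & argmax A f = class i].
Proof. by rewrite inE => /and3P[? /eqP ? /asboolP ?]. Qed.

(** Induction on the size of the maximum set: if it meets two classes, a functional of [V]
    separating them perturbs [f] and shrinks it. *)
Lemma class_reps_argmax f i : (f <= V)%MS -> i \in A ->
  exists2 j, j \in class_reps & j \in argmax A f.
Proof.
move=> fV iA; have [m] := ubnP #|argmax A f|.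
elim: m f fV => // m IH f fV; rewrite ltnS => le_m.
have [j jM] := argmax_neq0 f iA; have jA := argmaxW jM.
have [|] := boolP [forall z in argmax A f, same z j].
  move=> /forall_inP h; have [rA rj] := class_repP jA.
  have rM : class_rep j \in argmax A f.
    by apply: (argmax_max jM rA); rewrite (same_eqP _ _ rj).
  exists (class_rep j) => //; rewrite inE rA (eq_class_rep rA rj) eqxx /=.
  apply/asboolP; exists f => //; apply/setP => z; rewrite [RHS]inE.
  apply/idP/andP => [zM|[zA zr]].
    split; first exact: argmaxW zM.
    by apply: same_trans (h z zM) _; rewrite same_sym.
  by apply: (argmax_max rM zA); rewrite (same_eqP _ _ zr).
rewrite negb_forall_in => /exists_inP[z zM /not_same[g gV lt_g]].
have [e e_gt0 [fgM _]] := perturb A f g.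
have [| |k kr kM] := IH (f + e *: g).
- by rewrite addmx_sub ?scalemx_sub.
- apply: leq_trans le_m; rewrite fgM; apply: proper_card.
  apply/fintype.properP; split; first by apply/fintype.subsetP => t /argmaxW.
  by exists z => //; apply/negP => /argmaxP[_ /(_ j jM)]; rewrite leNgt lt_g.
by exists k => //; rewrite fgM in kM; exact: argmaxW kM.
Qed.

Lemma class_reps_same i j : i \in class_reps -> j \in class_reps -> same i j -> i = j.
Proof. by move=> /class_repsP[iA ri _] /class_repsP[_ rj _] /(eq_class_rep iA); rewrite ri rj. Qed.

(** If a maximum [z] lay outside the class of [i], perturbing [f] by some [g] with [g 0 i < g 0 z]
    would give a maximal representative among the maxima of [f]. It must be [i], yet [z] beats
    it. *)
Lemma argmax_class_reps i f : (f <= V)%MS -> argmax class_reps f = [set i] -> argmax A f = class i.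
Proof.
move=> fV fi.
have iR : i \in argmax class_reps f by rewrite fi set11.
have ir := argmaxW iR; have [iA _ _] := class_repsP ir.
have key j : j \in class_reps -> j \in argmax A f -> j = i.
  move=> jr /argmaxP[jA hj]; apply/set1P; rewrite -fi.
  by apply: (argmax_max iR jr); exact: hj.
have iM : i \in argmax A f.
  by have [j jr jM] := class_reps_argmax fV iA; rewrite -(key j jr jM).
apply/setP => z; rewrite [RHS]inE; apply/idP/andP => [zM|[zA zi]]; last first.
  by apply: (argmax_max iM zA); rewrite (same_eqP _ _ zi).
split; first exact: argmaxW zM.
rewrite same_sym; apply: contraT => /not_same[g gV lt_g].
have [e e_gt0 [fgM _]] := perturb A f g.
have [|j jr] := @class_reps_argmax (f + e *: g) _ _ iA.
  by rewrite addmx_sub ?scalemx_sub.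
rewrite fgM => /argmaxP[jM /(_ z zM)].
by rewrite (key j jr jM) leNgt lt_g.
Qed.


(** A functional of [V] attains its maximum and its minimum over [A] at representatives, so it
    vanishes on [A] once it vanishes on them. *)
Lemma config_class_reps W : config A W -> (V <= W)%MS -> ((const_mx 1 : 'rV[R]_n) <= V)%MS ->
  config class_reps V.
Proof.
move=> [_ injW vertW] VW oneV; split=> //.
  move=> f fV f0; apply: injW => [|i iA]; first exact: submx_trans VW.
  have [j jr /argmaxP[_ /(_ i iA)]] := class_reps_argmax fV iA.
  have [k kr /argmaxP[_ /(_ i iA)]] := class_reps_argmax (oppmx_sub fV) iA.
  rewrite !mxE (f0 j jr) (f0 k kr) oppr0 oppr_le0 => ge0 le0.
  by apply/le_anti; rewrite le0.
move=> i ir; have [iA ri [f fV fi]] := class_repsP ir; exists f => //.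
have iM : i \in argmax A f by rewrite fi inE iA samexx.
apply: set1_argmax => // z zr zi; have [zA _ _] := class_repsP zr.
rewrite lt_neqAle; have [_ -> //] := argmaxP _ _ _ iM; rewrite andbT.
apply: contra zi => /eqP fzi; apply/eqP/class_reps_same => //.
have : z \in argmax A f by apply: (argmax_max iM zA); rewrite fzi.
by rewrite fi inE => /andP[].
Qed.

(** In [A] the top and bottom faces of [f] are the classes of [i] and [j]; [exists_antipodal] keeps
    [i] and picks a suitable [q] in the class of [j]. *)
Lemma antipodal_lift W i j : config A W -> (V <= W)%MS ->
  antipodal class_reps V i j ->
  exists2 q, antipodal A W i q & class_rep i = i /\ class_rep q = j.
Proof.
move=> cW VW ij; have [/class_repsP[iA ri _] /class_repsP[jA rj _]] := antipodal_in ij.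
case: ij => f [fV /(argmax_class_reps fV) fi /(argmax_class_reps (oppmx_sub fV)) fj].
have [|q qM iq] := @exists_antipodal A W f i cW (submx_trans fV VW).
  by rewrite fi inE iA samexx.
exists q => //; split=> //; move: qM; rewrite fj inE => /andP[qA qj].
by rewrite (eq_class_rep qA qj).
Qed.

End Reduction.

End Configurations.

(** * Facets *)

Section Ranks.
Variables (R : fieldType) (n : nat).
Implicit Types (B : {set 'I_n}) (f : 'rV[R]_n).

Lemma rank_support m (M : 'M[R]_(m, n)) B :
  (forall i j, j \notin B -> M i j = 0) -> (\rank M <= #|B|)%N.
Proof.
move=> M0.
have -> : M = (\matrix_(i < m, k < #|B|) M i (enum_val k)) *m
              (\matrix_(k < #|B|, j < n) (enum_val k == j)%:R).
  apply/matrixP => i j; rewrite mxE; under eq_bigr do rewrite !mxE.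
  rewrite -(big_enum_val (fun z => M i z * (z == j)%:R)) /=.
  have [jB|jB] := boolP (j \in B).
    rewrite (bigD1 j) //= eqxx mulr1 big1 ?addr0 // => z /andP[_ /negPf ->].
    by rewrite mulr0.
  rewrite M0 // big1 // => z zB; case: eqP => [zj|]; last by rewrite mulr0.
  by rewrite -zj zB in jB.
exact: leq_trans (mxrankM_maxr _ _) (rank_leq_row _).
Qed.

Definition restr B : 'M[R]_n := diag_mx (\row_j (j \in B)%:R).

Lemma mul_restr m (M : 'M[R]_(m, n)) B i j : (M *m restr B) i j = M i j * (j \in B)%:R.
Proof. by rewrite /restr mul_mx_diag !mxE. Qed.

(** Rank-nullity for the restriction to [B]: the image has rank at most [#|B|], and the kernel lies
    in [V]. *)
Lemma rank_le_vanish m p (W : 'M[R]_(m, n)) (V : 'M[R]_(p, n)) B :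
  (forall f, (f <= W)%MS -> (forall i, i \in B -> f 0 i = 0) -> (f <= V)%MS) ->
  (\rank W <= #|B| + \rank V)%N.
Proof.
move=> h; rewrite -(mxrank_mul_ker W (restr B)) leq_add //.
  by apply: rank_support => i j jB; rewrite mul_restr (negPf jB) mulr0.
apply: mxrankS; apply/row_subP => i; apply: h.
  by apply: submx_trans (row_sub i _) (capmxSl _ _).
move=> j jB; have : (row i (W :&: kermx (restr B)) <= kermx (restr B))%MS.
  by apply: submx_trans (row_sub i _) (capmxSr _ _).
by move=> /sub_kermxP /matrixP/(_ 0 j); rewrite mul_restr jB mulr1 [RHS]mxE.
Qed.

End Ranks.

Section Facet.
Variables (R : realFieldType) (n : nat).
Implicit Types (A B : {set 'I_n}) (f g : 'rV[R]_n) (i j : 'I_n) (W : 'M[R]_n).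

Definition zeros A f : {set 'I_n} := [set i in A | f 0 i == 0].

(** The supporting hyperplane is normalized to [f = 0], with [A] on the side [f <= 0]; in a
    configuration [f != 0] makes the face proper. *)
Definition supporting A W f := [/\ (f <= W)%MS, f != 0,
  (forall i, i \in A -> f 0 i <= 0) & zeros A f != finset.set0].

Lemma exists_supporting A W : config A W -> (1 < \rank W)%N -> exists f, supporting A W f.
Proof.
move=> [oneW injW _] W1.
have [i iA] : exists i, i \in A.
  case: (set_0Vmem A) => [A0|[i iA]]; last by exists i.
  suff W0 : W = 0 by rewrite W0 mxrank0 in W1.
  by apply/row_matrixP => i; rewrite row0; apply: injW; rewrite ?row_sub // A0 => j; rewrite inE.
have [r hr] : exists r, ~~ (row r W <= (const_mx 1 : 'rV[R]_n))%MS.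
  apply/existsP; rewrite -negb_forall; apply: contraL W1 => /forallP h.
  rewrite -leqNgt; apply: leq_trans (rank_leq_row (const_mx 1 : 'rV[R]_n)).
  by apply: mxrankS; apply/row_subP.
have [j jM] := argmax_neq0 (row r W) iA; have [jA hj] := argmaxP _ _ _ jM.
have E z : (row r W - row r W 0 j *: const_mx 1) 0 z = row r W 0 z - row r W 0 j.
  by rewrite [row r W]lock !mxE mulr1.
exists (row r W - row r W 0 j *: const_mx 1); split.
- by rewrite addmx_sub ?row_sub // oppmx_sub // scalemx_sub.
- by apply: contra hr; rewrite subr_eq0 => /eqP ->; exact: scalemx_sub.
- by move=> z zA; rewrite E subr_le0 hj.
- apply/set0Pn; exists j.
  by rewrite inE jA E subrr eqxx.
Qed.

(** Take a supporting functional with the most zeros. If [g] vanishes on them without being a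
    multiple of [f], tilting [f] by [g] yields more zeros. The second clause thus says that the
    zeros span a hyperplane. *)
Lemma exists_facet A W : config A W -> (1 < \rank W)%N ->
  exists2 f, supporting A W f &
    forall g, (g <= W)%MS -> (forall i, i \in zeros A f -> g 0 i = 0) -> (g <= f)%MS.
Proof.
move=> cW W1; have [f0 sf0] := exists_supporting cW W1.
pose P (F : {set 'I_n}) := `[< exists2 f, supporting A W f & zeros A f = F >].
have P0 : P (zeros A f0) by apply/asboolP; exists f0.
case: (@arg_maxnP _ _ P (fun F => #|F|) P0) => F /asboolP[f sf <-] maxF {F}.
exists f => // g gW g0; have [fW f_neq0 f_le0 /set0Pn[k kF]] := sf.
have [_ injW _] := cW.
wlog [i [iA gi]] : g gW g0 / exists i, i \in A /\ g 0 i < 0.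
  move=> wl; have [->|] := eqVneq g 0; first exact: sub0mx.
  move=> g_neq0.
  have [i iA gi] : exists2 i, i \in A & g 0 i != 0.
    apply: contra_neqP g_neq0 => h; apply: injW => // i iA.
    by apply/eqP/contraT => gi; case: h; exists i.
  have [gi_lt|gi_ge] := ltP (g 0 i) 0; first by apply: wl => //; exists i.
  rewrite -[g]opprK oppmx_sub // wl ?oppmx_sub //.
    by move=> z zF; rewrite mxE g0 ?oppr0.
  by exists i; split=> //; rewrite mxE oppr_lt0 lt_neqAle eq_sym gi.
have nzA z : z \in A -> z \notin zeros A f -> f 0 z < 0.
  by move=> zA; rewrite inE zA /= lt_neqAle f_le0 // andbT.
have iF : i \notin zeros A f by apply: contraTN gi => /g0 ->; rewrite ltxx.
pose Q z := (z \in A) && (z \notin zeros A f).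
have Qi : Q i by rewrite /Q iA.
(* Tilting the hyperplane of [f] about its zeros, in the direction of [g],
   until it hits a further point. *)
case: (Order.TotalTheory.arg_maxP (fun z => g 0 z / f 0 z) Qi) => j /andP[jA jF] jmax.
set t := g 0 j / f 0 j in jmax.
have fj := nzA _ jA jF.
pose h := t *: f - g.
have [h0|h_neq0] := eqVneq h 0.
  by rewrite (_ : g = t *: f) ?scalemx_sub //; apply/esym/eqP; rewrite -subr_eq0 -/h h0.
have hE z : h 0 z = t * f 0 z - g 0 z by rewrite !mxE.
have hF z : z \in zeros A f -> h 0 z = 0.
  by move=> zF; rewrite hE g0 //; move: zF; rewrite inE => /andP[_ /eqP ->]; rewrite mulr0 subr0.
have : P (zeros A h).
  apply/asboolP; exists h => //; split=> //.
  - by rewrite addmx_sub ?scalemx_sub // oppmx_sub.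
  - move=> z zA; have [/hF -> //|zF] := boolP (z \in zeros A f).
    have := jmax z; rewrite /Q zA zF => /(_ isT) /=.
    by rewrite hE ler_ndivrMr ?nzA // subr_le0.
  - by apply/set0Pn; exists k; rewrite inE hF // eqxx andbT; move: kF; rewrite inE => /andP[].
move=> /maxF /=; rewrite leqNgt => /negP[]; apply: proper_card.
apply/fintype.properP; split.
  by apply/fintype.subsetP => z zF; rewrite inE hF // eqxx andbT; move: zF; rewrite inE => /andP[].
exists j => //; rewrite inE jA hE /t divfK ?subrr ?eqxx //.
by rewrite lt_eqF.
Qed.

Lemma zeros_argmax A W f : supporting A W f -> argmax A f = zeros A f.
Proof.
move=> [_ _ f_le0 /set0Pn[k]]; rewrite inE => /andP[kA /eqP fk].
apply/setP => z; rewrite [RHS]inE; apply/argmaxP/andP => -[zA].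
  by move=> /(_ k kA); rewrite fk => fz; split=> //; apply/eqP/le_anti; rewrite fz f_le0.
by move=> /eqP ->.
Qed.

End Facet.

(** * The lower bound for configurations *)

Lemma leq_card_disjoint3 (T : finType) (S S1 S2 S3 : {set T}) :
  S1 \subset S -> S2 \subset S -> S3 \subset S ->
  [disjoint S1 & S2] -> [disjoint S1 & S3] -> [disjoint S2 & S3] ->
  (#|S1| + #|S2| + #|S3| <= #|S|)%N.
Proof.
move=> s1 s2 s3 d12 d13 d23.
apply: leq_trans (subset_leq_card (_ : S1 :|: S2 :|: S3 \subset S)); last first.
  by rewrite !finset.subUset s1 s2.
have /eqP -> : #|S1 :|: S2 :|: S3| == (#|S1 :|: S2| + #|S3|)%N.
  by rewrite (leq_card_setU _ _).2 finset.disjoints_subset finset.subUset -!finset.disjoints_subset d13.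
by have /eqP -> : #|S1 :|: S2| == (#|S1| + #|S2|)%N by rewrite (leq_card_setU _ _).2.
Qed.

(** Raising the rank from D + 1 to D + g + 1 asks for 2 D g + g (g + 1) more pairs. The gain 2 v g
    leaves at most 2 e g + g - g^2 missing, where [e] bounds the shortfall of [v] from D + g. The
    growth 2 z e + e^2 + e of the excess term pays for that. *)
Lemma core_arith (D g v e x z N N' : nat) : (0 < g)%N -> (e <= g)%N ->
 (g <= z + e)%N -> (x <= z)%N -> (D + g <= v + e)%N ->
 (N' + 2 * v * g <= N)%N -> (D.+1 * D <= N' + x * x.+1)%N ->
 ((D + g).+1 * (D + g) <= N + (z + e) * (z + e).+1)%N.
Proof.
move=> g0 eg gz xz Dv NN IH.
have xz2 : (x * x.+1 <= z * z.+1)%N by exact: leq_mul.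
have h1 : (g * (D + g) <= g * (v + e))%N by exact: leq_mul.
have h2 : (e * g <= e * (z + e))%N by exact: leq_mul.
(* This is e (e - 1) <= g (g - 1), written without subtraction. *)
have h3 : (g + e * e <= g * g + e)%N.
  have -> : g = (g - e + e)%N by rewrite subnK.
  move: (g - e)%N => [|s]; lia.
lia.
Qed.

(** [D] and [D'] are the ranks before and after the projection, [a] and [r] the numbers of points,
    [F] and [F1] the sizes of the facet and of the opposite face, [v] the number of vertices of the
    projected facet. Since [g < F1], the gain 2 v (F1 - 1) is at least 2 v g. *)
Lemma merge_arith (D D' g v a F F1 r N N' : nat) :
  (D' + g = D)%N -> (0 < g)%N -> (g < F1)%N -> (D <= F + 1)%N -> (v <= F)%N ->
  (D' <= v + 1)%N -> (0 < D')%N -> (D' <= r)%N -> (F + F1 <= a)%N ->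
  (r + F + F1 <= v + 1 + a)%N -> (N' + 2 * v * F1 <= N + 2 * v)%N ->
  (D' * D'.-1 <= N' + (r - D') * (r - D').+1)%N ->
  (D * D.-1 <= N + (a - D) * (a - D).+1)%N.
Proof.
case: D' => // D' <- g0 gF1 DF vF Dv _ D'r aF rle Nle IH.
have Nle' : (N' + 2 * v * g <= N)%N.
  have : (v * g.+1 <= v * F1)%N by exact: leq_mul.
  lia.
set e := (D' + g - v)%N.
have -> : (a - (D'.+1 + g) = (a - (D'.+1 + g) - e) + e)%N by lia.
rewrite addSn /=; apply: (@core_arith D' g v e (r - D'.+1) _ N N') => //; lia.
Qed.

Lemma merge_count (s s' s1 s2 s3 f1 v : nat) :
  (s' <= s1 + 2 * v)%N -> (f1 * v <= s2)%N -> (f1 * v <= s3)%N ->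
  (s1 + s2 + s3 <= s)%N -> (s' + 2 * v * f1 <= s + 2 * v)%N.
Proof. by rewrite -mulnA [(v * f1)%N]mulnC; move: (f1 * v)%N; lia. Qed.

(** The rank rises by one, which asks for 2 (D + 1) more pairs; the 2 m pairs at the hidden point
    supply them, and [r < a] keeps the excess from decreasing. *)
Lemma hidden_arith (D m r a s s' s1 : nat) :
  (D.+1 * D <= s' + (r - D.+1) * (r - D.+1).+1)%N -> (s' <= s1)%N ->
  (s1 + m + m <= s)%N -> (D.+1 <= m)%N -> (r < a)%N -> (D.+1 <= r)%N ->
  (D.+2 * D.+1 <= s + (a - D.+2) * (a - D.+2).+1)%N.
Proof.
move=> IH s1' hs Dm ra Dr.
have : ((r - D.+1) * (r - D.+1).+1 <= (a - D.+2) * (a - D.+2).+1)%N by apply: leq_mul; lia.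
move: ((r - D.+1) * _)%N ((a - D.+2) * _)%N IH => x y IH xy.
lia.
Qed.

Section Bound.
Variables (R : realFieldType) (n : nat).
Implicit Types (A B : {set 'I_n}) (f g : 'rV[R]_n) (i j : 'I_n) (W : 'M[R]_n).

Lemma rank_config A W : config A W -> (\rank W <= #|A|)%N.
Proof.
move=> [_ injW _]; rewrite -[X in (_ <= X)%N]addn0 -(@mxrank0 R 1 n).
by apply: rank_le_vanish => f fW f0; rewrite (injW f) ?sub0mx.
Qed.


Lemma rank_const A W V i : config A W -> (V <= W)%MS -> i \in A ->
  (forall j, j \in A -> same V i j) -> (\rank V <= 1)%N.
Proof.
move=> [oneW injW _] VW iA h.
apply: leq_trans (rank_leq_row (const_mx 1 : 'rV[R]_n)).
apply: mxrankS; apply/row_subP => r.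
suff /eqP : row r V - row r V 0 i *: const_mx 1 = 0.
  by rewrite subr_eq0 => /eqP ->; exact: scalemx_sub.
have rV : (row r V <= V)%MS := row_sub r V.
apply: injW.
  by rewrite addmx_sub ?(submx_trans rV) // oppmx_sub // scalemx_sub.
move=> j /h /same_eqP /(_ _ rV) ->.
by rewrite [row r V]lock !mxE mulr1 subrr.
Qed.

Definition class_rep2 A W (x : 'I_n * 'I_n) := (class_rep A W x.1, class_rep A W x.2).

(** Since every pair of the image lifts, taking representatives maps the right-hand set onto the
    left-hand one. [E] removes pairs to be counted separately with more lifts. *)
Lemma card_lift A W V (E : {set 'I_n * 'I_n}) :
  config A W -> (V <= W)%MS ->
  (#|antipodal_set (class_reps A V) V :\: E| <=
   #|[set x in antipodal_set A W | class_rep2 A V x \in antipodal_set (class_reps A V) V :\: E]|)%N.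
Proof.
move=> cW VW; set S' := _ :\: E.
apply: leq_trans (leq_imset_card (class_rep2 A V) _); apply: subset_leq_card.
apply/fintype.subsetP => -[i j] ijS.
have /asboolP ij : `[< antipodal (class_reps A V) V i j >].
  by move: ijS; rewrite inE => /andP[_]; rewrite inE.
have [q iq [ri rq]] := antipodal_lift cW VW ij.
apply/imsetP; exists (i, q); last by rewrite /class_rep2 /= ri rq.
rewrite inE /class_rep2 /= ri rq ijS andbT inE.
exact/asboolP.
Qed.

Variables (A : {set 'I_n}) (W : 'M[R]_n) (f : 'rV[R]_n).
Hypotheses (cW : config A W) (W1 : (1 < \rank W)%N).
Hypotheses (sf : supporting A W f).
Hypothesis (facet :
  forall g, (g <= W)%MS -> (forall i, i \in zeros A f -> g 0 i = 0) -> (g <= f)%MS).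

Let F := zeros A f.
Let F1 := argmax A (- f).

Lemma facet_card : (\rank W <= #|F| + 1)%N.
Proof.
apply: leq_trans (rank_le_vanish facet) _.
by rewrite leq_add2l rank_leq_row.
Qed.

Lemma opposite_lt0 i : i \in F1 -> f 0 i < 0.
Proof.
move=> /argmaxP[iA hi]; have [fW f_neq0 f_le0 _] := sf; have [_ injW _] := cW.
rewrite lt_neqAle f_le0 // andbT; apply: contra f_neq0 => /eqP fi.
apply/eqP/injW => // j jA; apply/le_anti; rewrite f_le0 //=.
by have := hi j jA; rewrite !mxE fi oppr0 oppr_le0.
Qed.

Lemma facet_opposite i : i \in F -> i \notin F1.
Proof.
by rewrite inE => /andP[_ /eqP fi]; apply/negP => /opposite_lt0; rewrite fi ltxx.
Qed.

Lemma facet_argmax : argmax A f = F. Proof. exact: zeros_argmax sf. Qed.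

Lemma facetW : {subset F <= A}. Proof. by move=> z; rewrite inE => /andP[]. Qed.
Lemma oppositeW : {subset F1 <= A}. Proof. by move=> z /argmaxW. Qed.


(** * Opposite face a single point: the projection hiding that point *)

Section Hidden.
Variable p : 'I_n.
Hypothesis F1p : F1 = [set p].

(** The kernel of [C] consists of the functionals whose value at [p] is their mean over the
    facet. *)
Let C : 'cV[R]_n := \col_i ((i \in F)%:R - (i == p)%:R * #|F|%:R).
Let V := (W :&: kermx C)%MS.

Lemma mul_hidden g : (g *m C) 0 0 = \sum_(i in F) g 0 i - g 0 p * #|F|%:R.
Proof.
rewrite mxE; under eq_bigr do rewrite mxE mulrBr.
rewrite big_split /= sumrN [in RHS]big_mkcond /=; congr (_ - _).
  by apply: eq_bigr => i _; case: (i \in F); rewrite (mulr0, mulr1).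
rewrite (bigD1 p) //= eqxx mul1r big1 ?addr0 // => i /negPf ->.
by rewrite mul0r mulr0.
Qed.

Lemma hiddenP g : reflect ((g <= W)%MS /\ \sum_(i in F) g 0 i = g 0 p * #|F|%:R) (g <= V)%MS.
Proof.
rewrite sub_capmx; apply: (iffP andP) => -[gW].
  move=> /sub_kermxP /matrixP /(_ 0 0); rewrite mul_hidden mxE => /eqP.
  by rewrite subr_eq0 => /eqP.
move=> gp; split=> //; apply/sub_kermxP/matrixP => i j.
by rewrite !ord1 mul_hidden gp subrr mxE.
Qed.

Let pF1 : p \in F1. Proof. by rewrite F1p set11. Qed.
Let pA : p \in A. Proof. exact: oppositeW pF1. Qed.

Lemma hidden_cst : ((const_mx 1 : 'rV[R]_n) <= V)%MS.
Proof.
apply/hiddenP; split; first by case: cW.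
by under eq_bigr do rewrite mxE; rewrite mxE mul1r sumr_const.
Qed.

(** [C] has one column, and [f] is not in its kernel: its mean over the facet is 0 while it is
    negative at [p]. *)
Lemma rank_hidden : (\rank W = (\rank V).+1)%N.
Proof.
have [fW _ _ /set0Pn[k kF]] := sf; rewrite -/F in kF.
have F_gt0 : (0 < #|F|)%N by apply/card_gt0P; exists k.
rewrite -(mxrank_mul_ker W C) -/V.
suff -> : \rank (W *m C) = 1%N by [].
apply/eqP; rewrite eqn_leq rank_leq_col lt0n mxrank_eq0.
apply: contraTN (opposite_lt0 pF1) => /eqP WC.
have : (f <= kermx C)%MS by apply: submx_trans fW _; apply/sub_kermxP.
move=> fC; have /hiddenP[_] : (f <= V)%MS by rewrite sub_capmx fW.
rewrite big1; last by move=> i; rewrite inE => /andP[_ /eqP].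
by move=> /esym/eqP; rewrite mulf_eq0 pnatr_eq0 (gtn_eqF F_gt0) orbF => /eqP ->; rewrite ltxx.
Qed.

(* [p] sits over the barycenter of the facet, so that a functional of [V] which
   is maximal at [p] is constant on the facet, hence everywhere. *)
Lemma hidden_not_repr i : (1 < \rank V)%N -> i \in class_reps A V -> ~~ same V p i.
Proof.
move=> V1 /class_repsP[iA _ [g gV gi]]; apply: contraL V1 => pi; rewrite -leqNgt.
have pM : p \in argmax A g by rewrite gi inE pA.
have [_ hp] := argmaxP _ _ _ pM; have [gW gp] := hiddenP _ gV.
have gF j : j \in F -> g 0 j = g 0 p.
  move=> jF; apply/esym/subr0_eq; move: j jF; apply: psumr_eq0P.
    by move=> j /facetW jA; rewrite subr_ge0 hp.
  by rewrite sumrB gp sumr_const mulr_natr subrr.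
have [oneW injW _] := cW.
have /sub_rVP[t gt] : (g - g 0 p *: const_mx 1 <= f)%MS.
  apply: facet; first by rewrite addmx_sub // oppmx_sub // scalemx_sub.
  by move=> j jF; rewrite !mxE gF // mulr1 subrr.
have /eqP : (g - g 0 p *: const_mx 1) 0 p = 0 by rewrite !mxE mulr1 subrr.
rewrite gt mxE mulf_eq0 (lt_eqF (opposite_lt0 pF1)) orbF => /eqP t0.
move: gt; rewrite t0 scale0r => /eqP; rewrite subr_eq0 => /eqP gE.
apply: (rank_const cW (capmxSl _ _) iA) => j jA.
have : j \in argmax A g.
  by apply/argmaxP; split=> // z zA; rewrite gE !mxE.
by rewrite gi inE jA same_sym.
Qed.

Lemma antipodal_facet j : j \in F -> antipodal A W p j /\ antipodal A W j p.
Proof.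
have [fW _ _ _] := sf; rewrite -facet_argmax => jF.
have [q] := exists_antipodal cW fW jF.
rewrite -/F1 F1p => /set1P -> jp; split=> //; exact: antipodal_sym.
Qed.

Lemma hidden_bound : ((1 < \rank V)%N ->
    (\rank V * (\rank V).-1 <= #|antipodal_set (class_reps A V) V| +
       (#|class_reps A V| - \rank V) * (#|class_reps A V| - \rank V).+1)%N) ->
  (\rank W * (\rank W).-1 <=
     #|antipodal_set A W| + (#|A| - \rank W) * (#|A| - \rank W).+1)%N.
Proof.
have VW : (V <= W)%MS := capmxSl _ _.
pose S := antipodal_set A W; set S' := antipodal_set _ _.
pose S1 := [set x in S | class_rep2 A V x \in S'].
pose S2 := [set (p, j) | j in F]; pose S3 := [set (j, p) | j in F].
have cS2 : #|S2| = #|F| by rewrite card_imset // => ? ? [].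
have cS3 : #|S3| = #|F| by rewrite card_imset // => ? ? [].
have sS2 : S2 \subset S.
  by apply/fintype.subsetP => _ /imsetP[j jF ->]; rewrite inE; apply/asboolP; case: (antipodal_facet jF).
have sS3 : S3 \subset S.
  by apply/fintype.subsetP => _ /imsetP[j jF ->]; rewrite inE; apply/asboolP; case: (antipodal_facet jF).
have d23 : [disjoint S2 & S3].
  apply/pred0P => x /=; apply/negbTE/negP => /andP[/imsetP[j jF ->] /imsetP[i iF [pi _]]].
  by move: pF1; rewrite pi (negPf (facet_opposite iF)).
have DF := facet_card; rewrite rank_hidden in DF *.
(* If [\rank V] is 1, the bound asks for two ordered pairs, and [p] with one point of the facet
   gives them. *)
have [V1 /(_ isT) IH|V1 _] := ltnP 1 (\rank V); last first.
  have := @leq_card_disjoint3 _ S finset.set0 S2 S3.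
  rewrite finset.sub0set cards0 cS2 cS3 => /(_ isT sS2 sS3).
  rewrite -!finset.setI_eq0 !finset.set0I finset.setI_eq0 => /(_ (eqxx _) (eqxx _) d23) /=.
  have V_eq1 : \rank V = 1%N by move: W1; rewrite rank_hidden; lia.
  move: DF; rewrite V_eq1 /= add0n addn1 ltnS => F_gt0 hS.
  by apply: leq_trans (leq_addr _ _); apply: leq_trans hS; exact: (leq_add F_gt0 F_gt0).
(* Lifted pairs avoid [p], whose class is not a vertex of the image; hence they are disjoint from
   [S2] and [S3]. *)
have pS1 x : x \in S1 -> x.1 != p /\ x.2 != p.
  rewrite inE => /andP[xS]; rewrite inE => /asboolP /antipodal_in[/= r1 r2].
  move: xS; rewrite inE => /asboolP /antipodal_in[x1 x2].
  have [_ s1] := class_repP V x1; have [_ s2] := class_repP V x2.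
  split; [move: (hidden_not_repr V1 r1)|move: (hidden_not_repr V1 r2)];
    by apply: contraNneq => <-; rewrite same_sym.
have d12 : [disjoint S1 & S2].
  apply/pred0P => x /=; apply/negbTE/negP => /andP[/pS1[x1 _] /imsetP[j jF xE]].
  by rewrite xE eqxx in x1.
have d13 : [disjoint S1 & S3].
  apply/pred0P => x /=; apply/negbTE/negP => /andP[/pS1[_ x2] /imsetP[j jF xE]].
  by rewrite xE eqxx in x2.
have sS1 : S1 \subset S by apply/fintype.subsetP => x; rewrite inE => /andP[].
have cS1 : (#|S'| <= #|S1|)%N.
  by have := card_lift finset.set0 cW VW; rewrite finset.setD0.
have := leq_card_disjoint3 sS1 sS2 sS3 d12 d13 d23; rewrite cS2 cS3 => hS.
have rA : (#|class_reps A V| < #|A|)%N.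
  apply: proper_card; apply/fintype.properP; split.
    by apply/fintype.subsetP => i /class_repsP[].
  by exists p => //; apply/negP => /(hidden_not_repr V1); rewrite samexx.
have Vr : (\rank V <= #|class_reps A V|)%N.
  exact: rank_config (config_class_reps cW VW hidden_cst).
rewrite addn1 ltnS in DF.
move: V1 IH DF Vr; case: (\rank V) => // D _ /= IH DF Vr.
exact: hidden_arith IH cS1 hS DF rA Vr.
Qed.

End Hidden.


(** * Opposite face with several points: the projection merging them *)

Section Merge.
Variable p : 'I_n.
Hypothesis pF1 : p \in F1.
Hypothesis F1_gt1 : (1 < #|F1|)%N.

(** Column j of [M *m C] is the difference of columns j and p of [M] for j in [F1], and 0 otherwise;
    the kernel is the functionals constant on [F1]. *)
Let C : 'M[R]_n := \matrix_(i, j) (((i == j)%:R - (i == p)%:R) * (j \in F1)%:R).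
Let V := (W :&: kermx C)%MS.
Let Fr := class_reps A V :&: F.

Lemma mul_merge m (M : 'M[R]_(m, n)) (i : 'I_m) j :
  (M *m C) i j = (M i j - M i p) * (j \in F1)%:R.
Proof.
rewrite mxE; under eq_bigr do rewrite mxE mulrA mulrBr.
rewrite -mulr_suml; congr (_ * _); rewrite big_split /= sumrN.
rewrite (bigD1 j) //= eqxx mulr1 big1 ?addr0; last first.
  by move=> k /negPf ->; rewrite mulr0.
rewrite (bigD1 p) //= eqxx mulr1 big1 ?addr0 //.
by move=> k /negPf ->; rewrite mulr0.
Qed.

Lemma mergeP g :
  reflect ((g <= W)%MS /\ forall i, i \in F1 -> g 0 i = g 0 p) (g <= V)%MS.
Proof.
rewrite sub_capmx; apply: (iffP andP) => -[gW].
  move=> /sub_kermxP /matrixP gC; split=> // i iF; have := gC 0 i.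
  by rewrite mul_merge iF mulr1 mxE => /subr0_eq.
move=> gp; split=> //; apply/sub_kermxP/matrixP => i j.
rewrite !ord1 mul_merge mxE; have [/gp ->|_] := boolP (j \in F1); last exact: mulr0.
by rewrite subrr mul0r.
Qed.

Let VW : (V <= W)%MS := capmxSl _ _.
Let pA : p \in A. Proof. exact: oppositeW pF1. Qed.

Lemma merge_cst : ((const_mx 1 : 'rV[R]_n) <= V)%MS.
Proof. by apply/mergeP; split=> [|i _]; [case: cW | rewrite !mxE]. Qed.

Lemma merge_facet : (f <= V)%MS.
Proof.
apply/mergeP; split=> [|i iF]; first by case: sf.
by have /eqP := argmax_eq iF pF1; rewrite !mxE eqr_opp => /eqP.
Qed.

Lemma same_opposite i : i \in F1 -> same V i p.
Proof. by move=> iF; apply/same_eqP => g /mergeP[_ ->]. Qed.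

(** The drop is the rank of [W *m C]. It is positive because a functional exposing another point of
    [F1] separates it from [p], and below [#|F1|] because only the columns in [F1 :\ p] can be
    nonzero. *)
Lemma rank_merge : exists c, [/\ (\rank V + c = \rank W)%N, (0 < c)%N & (c < #|F1|)%N].
Proof.
exists (\rank (W *m C)); split; first by rewrite addnC -(mxrank_mul_ker W C).
  rewrite lt0n mxrank_eq0; apply/eqP => WC.
  have [i] : exists i, i \in F1 :\ p.
    by apply/card_gt0P; move: F1_gt1; rewrite (cardsD1 p) pF1.
  rewrite in_setD1 => /andP[ip iF]; have [_ _ vertW] := cW.
  have [h hW hi] := vertW i (oppositeW iF).
  have : h 0 p < h 0 i by apply: (argmax_set1 hi) => //; rewrite eq_sym.
  suff /mergeP[_ /(_ i iF) ->] : (h <= V)%MS by rewrite ltxx.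
  by rewrite sub_capmx hW; apply: submx_trans hW _; apply/sub_kermxP.
rewrite (cardsD1 p F1) pF1 ltnS; apply: rank_support => i j.
rewrite in_setD1 negb_and negbK mul_merge => /orP[/eqP ->|jF].
  by rewrite subrr mul0r.
by rewrite (negPf jF) mulr0.
Qed.

(** A representative maximizing [f + e *: g] for small [e] lies on the facet and maximizes [g]
    there. *)
Lemma face_rep g j : (g <= V)%MS -> j \in F -> exists2 k, k \in Fr & g 0 j <= g 0 k.
Proof.
move=> hV jF; have [e e_gt0 [hM _]] := perturb A f g.
have [|k kr] := @class_reps_argmax _ _ A V (f + e *: g) j _ (facetW jF).
  by rewrite addmx_sub ?merge_facet // scalemx_sub.
rewrite hM facet_argmax => /argmaxP[kF /(_ j jF) hk]; exists k => //.
by rewrite inE kr.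
Qed.

Lemma rank_face_reps : (\rank V <= #|Fr| + 1)%N.
Proof.
apply: leq_trans (rank_le_vanish (V := f) (B := Fr) _) _; last by rewrite leq_add2l rank_leq_row.
move=> h hV h0; apply: facet; first exact: submx_trans VW.
move=> j jF; have [k kF] := face_rep hV jF.
have [k' k'F] := face_rep (oppmx_sub hV) jF.
rewrite !mxE (h0 k kF) (h0 k' k'F) oppr0 oppr_le0 => ge0 le0.
by apply/le_anti; rewrite le0.
Qed.

(** With [h] exposing the class of [j], [f + e *: h] has its maxima on the facet inside that class,
    while its bottom face is still all of [F1], as [h] is constant there. So any [i] in [F1] can
    serve. *)
Lemma antipodal_merge i j : i \in F1 -> j \in Fr ->
  exists2 q, antipodal A W i q & class_rep A V q = j.
Proof.
move=> iF1; rewrite finset.in_setI => /andP[jr jF]; have [jA rj [h hV hj]] := class_repsP jr.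
have [e e_gt0 [hM hm]] := perturb A f h.
have iM : i \in argmax A (- (f + e *: h)).
  rewrite hm -/F1; apply/argmaxP; split=> // z zF.
  by have /mergeP[_ hc] := hV; rewrite !mxE !hc.
have [|q] := exists_antipodal cW _ iM.
  apply: oppmx_sub; rewrite addmx_sub ?scalemx_sub //; first by case: sf.
  exact: submx_trans VW.
rewrite opprK hM facet_argmax => /argmaxP[qF hq] iq; exists q => //.
have jM : j \in argmax A h by rewrite hj inE jA samexx.
have : q \in argmax A h by apply: (argmax_max jM (facetW qF)); exact: hq.
by rewrite hj inE => /andP[qA qj]; rewrite (eq_class_rep qA qj).
Qed.

Lemma merge_bound : ((\rank V < \rank W)%N ->
    (\rank V * (\rank V).-1 <= #|antipodal_set (class_reps A V) V| +
       (#|class_reps A V| - \rank V) * (#|class_reps A V| - \rank V).+1)%N) ->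
  (\rank W * (\rank W).-1 <=
     #|antipodal_set A W| + (#|A| - \rank W) * (#|A| - \rank W).+1)%N.
Proof.
have [g [Eg g_gt0 gF1]] := rank_merge => IH.
have {IH} IH := IH ltac:(lia).
have cV : config (class_reps A V) V by apply: config_class_reps VW merge_cst.
have V_gt0 : (0 < \rank V)%N.
  apply: leq_trans (mxrankS merge_cst); rewrite lt0n mxrank_eq0.
  by apply/eqP => /matrixP/(_ 0 p)/eqP; rewrite !mxE oner_eq0.
have FA : F \subset A by apply/fintype.subsetP; exact: facetW.
have F1A : F1 \subset A by apply/fintype.subsetP; exact: oppositeW.
have dF : [disjoint F & F1].
  by apply/pred0P => i /=; apply/negbTE/negP => /andP[/facet_opposite /negPf ->].
have cFF : #|F :|: F1| = (#|F| + #|F1|)%N by apply/eqP; rewrite (leq_card_setU _ _).2.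
pose r := class_rep A V p.
have [rA rp] := class_repP V pA; rewrite -/r in rA rp.
have rF : r \notin F.
  apply: contraTN (opposite_lt0 pF1); rewrite inE => /andP[_ /eqP fr].
  by rewrite -(same_eqP _ _ _ rp f merge_facet) fr ltxx.
have repF1 i : i \in F1 -> class_rep A V i = r.
  by move=> iF; apply: eq_class_rep (oppositeW iF) (same_opposite iF).
apply: (@merge_arith _ (\rank V) g #|Fr| #|A| #|F| #|F1| #|class_reps A V|
  #|antipodal_set A W| #|antipodal_set (class_reps A V) V|) => //.
- exact: facet_card.
- by apply/subset_leq_card/subsetIr.
- exact: rank_face_reps.
- exact: rank_config.
- by rewrite -cFF; apply: subset_leq_card; rewrite finset.subUset FA.
(* All of [F1] has the single representative [r], and on the facet only the [v] members of [Fr] are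
   vertices of the image. *)
- have : class_reps A V \subset Fr :|: [set r] :|: (A :\: (F :|: F1)).
    apply/fintype.subsetP => i ir; have [iA ri _] := class_repsP ir.
    rewrite finset.in_setU finset.in_setU finset.in_setI finset.in_set1 finset.in_setD finset.in_setU ir iA andbT /=.
    have [//|iF /=] := boolP (i \in F).
    have [iF1|iF1] := boolP (i \in F1); last by rewrite orbT.
    have ir' : i == r by rewrite -{1}ri repF1.
    by rewrite ir'.
  move=> /subset_leq_card; rewrite -addnA -cFF => h.
  have hA : #|A| = (#|F :|: F1| + #|A :\: (F :|: F1)|)%N.
    rewrite -(cardsID (F :|: F1) A); congr (_ + _)%N; congr #|pred_of_set _|.
    by apply/finset.setIidPr; rewrite finset.subUset FA.
  rewrite hA [X in (_ <= _ + X)%N]addnC addnA leq_add2r (leq_trans h) //.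
  rewrite (leq_trans (leq_card_setU _ _)) // leq_add2r.
  by rewrite (leq_trans (leq_card_setU _ _)) // cards1.
pose S := antipodal_set A W; set S' := antipodal_set _ V.
(* Pairs of the image joining the merged vertex to the projected facet: [S2] and [S3] count each of
   them [#|F1|] times, so [S1] must leave them out. *)
pose E := finset.setX [set r] Fr :|: finset.setX Fr [set r].
pose S1 := [set x in S | class_rep2 A V x \in S' :\: E].
pose S2 := [set x in S | (x.1 \in F1) && (class_rep A V x.2 \in Fr)].
pose S3 := [set x in S | (x.2 \in F1) && (class_rep A V x.1 \in Fr)].
have cS1 : (#|S'| <= #|S1| + 2 * #|Fr|)%N.
  apply: leq_trans (leq_add (card_lift E cW VW) (_ : #|E| <= _)%N).
    by rewrite -/S' -(cardsID E S') addnC leq_add2l subset_leq_card // subsetIr.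
  apply: leq_trans (leq_card_setU _ _) _.
  by rewrite !cardsX cards1 mul1n muln1 addnn -mul2n.
have cS2 : (#|F1| * #|Fr| <= #|S2|)%N.
  rewrite -cardsX; apply: leq_trans (leq_imset_card (fun x => (x.1, class_rep A V x.2)) _).
  apply: subset_leq_card; apply/fintype.subsetP => -[i j].
  rewrite finset.in_setX => /andP[/= iF jF]; have [q iq qj] := antipodal_merge iF jF.
  apply/imsetP; exists (i, q) => /=; last by rewrite qj.
  by rewrite inE /= qj iF jF !andbT inE; apply/asboolP.
have cS3 : (#|F1| * #|Fr| <= #|S3|)%N.
  rewrite -cardsX; apply: leq_trans (leq_imset_card (fun x => (x.2, class_rep A V x.1)) _).
  apply: subset_leq_card; apply/fintype.subsetP => -[i j].
  rewrite finset.in_setX => /andP[/= iF jF]; have [q iq qj] := antipodal_merge iF jF.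
  apply/imsetP; exists (q, i) => /=; last by rewrite qj.
  by rewrite inE /= qj iF jF !andbT inE; apply/asboolP/antipodal_sym.
have sS1 : S1 \subset S by apply/fintype.subsetP => x; rewrite inE => /andP[].
have sS2 : S2 \subset S by apply/fintype.subsetP => x; rewrite inE => /andP[].
have sS3 : S3 \subset S by apply/fintype.subsetP => x; rewrite inE => /andP[].
have d12 : [disjoint S1 & S2].
  apply/pred0P => x /=; apply/negbTE/negP => /andP[].
  rewrite [x \in S1]inE finset.in_setD [x \in S2]inE.
  move=> /and3P[_ xE _] /and3P[_ x1 x2]; move: xE; rewrite finset.in_setU !finset.in_setX /=.
  by rewrite repF1 // finset.in_set1 eqxx x2.
have d13 : [disjoint S1 & S3].
  apply/pred0P => x /=; apply/negbTE/negP => /andP[].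
  rewrite [x \in S1]inE finset.in_setD [x \in S3]inE.
  move=> /and3P[_ xE _] /and3P[_ x1 x2]; move: xE; rewrite finset.in_setU !finset.in_setX /=.
  by rewrite [class_rep A V x.2]repF1 // !finset.in_set1 eqxx x2 orbT.
have d23 : [disjoint S2 & S3].
  apply/pred0P => x /=; apply/negbTE/negP => /andP[].
  rewrite [x \in S2]inE [x \in S3]inE.
  move=> /and3P[_ x1 _] /and3P[_ _]; rewrite repF1 // finset.in_setI => /andP[_].
  by rewrite (negPf rF).
exact: merge_count cS1 cS2 cS3 (leq_card_disjoint3 sS1 sS2 sS3 d12 d13 d23).
Qed.

End Merge.

End Bound.

Theorem antipodal_bound (R : realFieldType) n (A : {set 'I_n}) (W : 'M[R]_n) :
  config A W ->
  (\rank W * (\rank W).-1 <=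
     #|antipodal_set A W| + (#|A| - \rank W) * (#|A| - \rank W).+1)%N.
Proof.
have [m] := ubnP (\rank W); elim: m A W => // m IH A W; rewrite ltnS => le_m cW.
have [W1|] := ltnP 1 (\rank W); last by case: (\rank W) => [|[]].
have [f sf facet] := exists_facet cW W1.
have [fW _ _ /set0Pn[k kF]] := sf.
have [p pF1] := argmax_neq0 (- f) (facetW kF).
have [F1_gt1|F1_le1] := ltnP 1 #|argmax A (- f)|.
  apply: (merge_bound cW W1 sf facet pF1 F1_gt1) => lt_V.
  apply: IH; first exact: leq_trans lt_V le_m.
  exact: config_class_reps cW (capmxSl _ _) (merge_cst f cW p).
have F1p : argmax A (- f) = [set p].
  by apply/eqP; rewrite eq_sym eqEcard finset.sub1set pF1 cards1.
apply: (hidden_bound cW W1 sf facet F1p) => _.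
apply: IH; first by rewrite (rank_hidden cW sf F1p) in le_m.
exact: config_class_reps cW (capmxSl _ _) (hidden_cst f cW p).
Qed.

(** * Point sets *)

Section Geometry.
Variables (R : realType) (d : nat).
Local Notation V := 'rV[R]_d.
Implicit Types (X : {fset V}) (u x y z : V) (b : R).

Lemma dotvD u x y : dotv u (x + y) = dotv u x + dotv u y.
Proof. by rewrite /dotv -big_split; apply: eq_bigr => i _; rewrite mxE mulrDr. Qed.

Lemma dotvZ u t x : dotv u (t *: x) = t * dotv u x.
Proof. by rewrite /dotv mulr_sumr; apply: eq_bigr => i _; rewrite mxE mulrCA. Qed.

Lemma dotNv u x : dotv (- u) x = - dotv u x.
Proof. by rewrite /dotv -sumrN; apply: eq_bigr => i _; rewrite mxE mulNr. Qed.

Lemma dot0v x : dotv 0 x = 0.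
Proof. by rewrite /dotv big1 // => i _; rewrite mxE mul0r. Qed.

Lemma dotv0 u : dotv u 0 = 0.
Proof. by rewrite /dotv big1 // => i _; rewrite mxE mulr0. Qed.

Lemma polytope_le X u b : (forall x, x \in X -> dotv u x <= b) ->
  forall x, polytope X x -> dotv u x <= b.
Proof.
move=> hX x; apply: (@smallest_sub _ _ _ [set z | dotv u z <= b]%classic); last first.
  by move=> z; exact: hX.
move=> y z t; rewrite !in_setE /= => yb zb.
rewrite [dotv _ _](_ : _ = t%:num * dotv u y + (1 - t%:num) * dotv u z); last first.
  by rewrite -!dotvZ -dotvD.
have [t0 t1] : 0 <= t%:num :> R /\ t%:num <= 1 :> R by [].
have -> : b = t%:num * b + (1 - t%:num) * b by ring.
by rewrite lerD // ler_wpM2l // subr_ge0.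
Qed.

Lemma sub_polytope X x : x \in X -> polytope X x.
Proof. by move=> xX; apply: sub_gen_smallest. Qed.

Lemma vertex_strict X x : strictly_convex_position X -> x \in X ->
  exists u, forall z, z \in X -> z != x -> dotv u z < dotv u x.
Proof.
move=> scp xX; have : [set` X]%classic x by [].
rewrite scp => -[u [b [hb ub]]]; exists u => z zX zx.
have [_ xb] : (polytope X `&` [set x | dotv u x = b])%classic x by rewrite ub.
rewrite [dotv u x]xb lt_neqAle hb ?andbT; last exact: sub_polytope.
apply: contra zx => /eqP zb; apply/eqP.
have : (polytope X `&` [set x | dotv u x = b])%classic z by split=> //; exact: sub_polytope.
by rewrite ub.
Qed.

(* [polytope X] is a hull over all convex sets: the candidate convex set used
   here adds to the open half-space only the vertex itself. *)
Lemma strict_vertex X x u : x \in X ->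
  (forall z, z \in X -> z != x -> dotv u z < dotv u x) -> vert (polytope X) x.
Proof.
move=> xX hu; exists u, (dotv u x); split.
  apply: polytope_le => z zX; have [-> //|zx] := eqVneq z x.
  exact/ltW/hu.
apply/seteqP; split=> [y [Py /= uy]|_ ->]; last by split=> //; exact: sub_polytope.
pose B := [set z | z = x \/ dotv u z < dotv u x]%classic.
suff /(_ _ Py) [//|] : (polytope X `<=` B)%classic by rewrite uy ltxx.
apply: smallest_sub; last first.
  by move=> z zX; have [->|zx] := eqVneq z x; [left | right; exact: hu].
move=> z w t; rewrite !in_setE /B /= => Bz Bw.
have E v : v = t%:num *: z + (1 - t%:num) *: w ->
    dotv u v = t%:num * dotv u z + (1 - t%:num) * dotv u w.
  by move=> ->; rewrite dotvD !dotvZ.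
have [t0 t1] : 0 <= t%:num :> R /\ t%:num <= 1 :> R by [].
set v : V := conv t z w; have vE : v = t%:num *: z + (1 - t%:num) *: w by [].
have {}E := E v vE.
have [t0'|t0'] := eqVneq (t%:num : R) 0.
  by move: vE; rewrite t0' scale0r add0r subr0 scale1r => ->.
have [t1'|t1'] := eqVneq (t%:num : R) 1.
  by move: vE; rewrite t1' subrr scale0r addr0 scale1r => ->.
have {t0'}t_gt0 : 0 < t%:num :> R by rewrite lt_neqAle eq_sym t0'.
have {t1'}t_lt1 : 0 < 1 - t%:num :> R by rewrite subr_gt0 lt_neqAle t1'.
have [[zx|zx] [wx|wx]] := (Bz, Bw).
- by left; rewrite vE zx wx -scalerDl addrC subrK scale1r.
- right; rewrite E zx; nra.
- right; rewrite E wx; nra.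
- right; rewrite E; nra.
Qed.

(** Conversely to exposing each point, a vertex of the polytope lies in [X]: the maximum of its
    functional is attained at a point of [X], and the face is a singleton. *)
Lemma strict_convex_position X : X != fset0 ->
  (forall x, x \in X -> exists u, forall z, z \in X -> z != x -> dotv u z < dotv u x) ->
  strictly_convex_position X.
Proof.
move=> /fset0Pn[x0 x0X] h; apply/seteqP; split=> [x xX|v [u [b [hb vb]]]].
  by have [u hu] := h x xX; exact: strict_vertex hu.
have [Pv uv] : (polytope X `&` [set x | dotv u x = b])%classic v by rewrite vb.
have [x xX xv] : exists2 x, x \in X & b <= dotv u x.
  apply: contrapT => hx.
  have : dotv u v <= \big[Num.max/dotv u x0]_(x <- X) dotv u x.
    by apply: polytope_le Pv => z zX; exact: le_bigmax_seq.
  apply/negP; rewrite -ltNge [dotv u v]uv.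
  have lt_b z : z \in X -> dotv u z < b.
    by move=> zX; rewrite ltNge; apply/negP => bz; apply: hx; exists z.
  by rewrite big_seq; apply: bigmax_lt => //; exact: lt_b.
have Px := sub_polytope xX.
have : (polytope X `&` [set x | dotv u x = b])%classic x.
  by split=> //; apply/le_anti; rewrite xv hb.
by rewrite vb => <-.
Qed.

(* A segment from a point of [X] off [H] to a point beyond [H] would meet [H],
   on which the functional defining it as a supporting hyperplane is maximal. *)
Lemma supporting_side X (H : set V) w a v z :
  supporting_hyperplane (polytope X) H -> H = hyperplane w a ->
  v \in X -> z \in X -> dotv w v < a -> dotv w z <= a.
Proof.
move=> [u [b [_ HE hb _]]] Ha vX zX va; rewrite leNgt; apply/negP => az.
have [lt_v lt_z] : dotv u v < b /\ dotv u z < b.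
  split; rewrite lt_neqAle hb ?andbT; try exact: sub_polytope.
    apply/eqP => vb; have : H v by rewrite HE.
    by rewrite Ha /hyperplane /= => va'; rewrite va' ltxx in va.
  apply/eqP => zb; have : H z by rewrite HE.
  by rewrite Ha /hyperplane /= => za'; rewrite za' ltxx in az.
pose t := (a - dotv w v) / (dotv w z - dotv w v).
have vz : 0 < dotv w z - dotv w v by rewrite subr_gt0 (lt_trans va).
have t0 : 0 < t by rewrite divr_gt0 // subr_gt0.
have t1 : t < 1 by rewrite ltr_pdivrMr // mul1r ltrD2r.
have : H (t *: z + (1 - t) *: v).
  rewrite Ha /hyperplane /= dotvD !dotvZ.
  have -> : t * dotv w z + (1 - t) * dotv w v = t * (dotv w z - dotv w v) + dotv w v by ring.
  by rewrite /t divfK ?subrK // gt_eqF.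
rewrite HE /hyperplane /= dotvD !dotvZ; nra.
Qed.

(** Parallel hyperplanes share a normal, which up to sign is larger at [x]. Each point lies off the
    other's hyperplane, which tells on which side of it [X] lies. *)
Lemma strictly_antipodalP X x y : strictly_antipodal X x y <->
  [/\ x \in X, y \in X, x <> y &
    exists u, (forall z, z \in X -> z != x -> dotv u z < dotv u x) /\
              (forall z, z \in X -> z != y -> dotv u y < dotv u z)].
Proof.
split=> [[xX yX xy [H' [H'' [sH' sH'' [[w [c [c' [w0 H'E H''E]]]] HH] Hx Hy]]]]|
  [xX yX xy [u [ux uy]]]]; split=> //; last first.
  have lt_yx : dotv u y < dotv u x.
    by apply: ux => //; apply/eqP => yx; apply: xy.
  have u0 : u != 0 by apply: contraTneq lt_yx => ->; rewrite !dot0v ltxx.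
  exists (hyperplane u (dotv u x)), (hyperplane u (dotv u y)); split.
  - exists u, (dotv u x); split=> //; last by exists x; split=> //; exact: sub_polytope.
    apply: polytope_le => z zX; by have [->|/(ux z zX)/ltW] := eqVneq z x.
  - exists (- u), (- dotv u y); split.
    + by rewrite oppr_eq0.
    + by apply/seteqP; split=> z; rewrite /hyperplane /= dotNv; [move=> ->|move/oppr_inj].
    + apply: polytope_le => z zX; rewrite dotNv lerN2.
      by have [->|/(uy z zX)/ltW] := eqVneq z y.
    + by exists y; split=> //; exact: sub_polytope.
  - split; first by exists u, (dotv u x), (dotv u y).
    move=> /seteqP[/(_ x)]; rewrite /hyperplane /= => /(_ erefl) xy0.
    by rewrite xy0 ltxx in lt_yx.
  - apply/seteqP; split=> [z [zX /= uz]|_ ->]; last by split.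
    by apply/eqP/contraT => /(ux z zX); rewrite uz ltxx.
  - apply/seteqP; split=> [z [zX /= uz]|_ ->]; last by split.
    by apply/eqP/contraT => /(uy z zX); rewrite uz ltxx.
have xH : H' x by have [] : ([set` X] `&` H')%classic x by rewrite Hx.
have yH : H'' y by have [] : ([set` X] `&` H'')%classic y by rewrite Hy.
have only H p z v b : ([set` X] `&` H)%classic = [set p]%classic -> H = hyperplane v b ->
    z \in X -> z != p -> dotv v z != b.
  move=> Hp HE zX; apply: contra => /eqP vz; apply/eqP.
  by have : ([set` X] `&` H)%classic z by [split=> //; rewrite HE]; rewrite Hp.
have hypN (v : V) b : hyperplane v b = hyperplane (- v) (- b).
  by apply/seteqP; split=> z; rewrite /hyperplane /= dotNv; [move=> ->|move/oppr_inj].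
have main v b b' : H' = hyperplane v b -> H'' = hyperplane v b' -> b' < b ->
    exists u, (forall z, z \in X -> z != x -> dotv u z < dotv u x) /\
              (forall z, z \in X -> z != y -> dotv u y < dotv u z).
  move=> vH' vH'' ltb.
  have vx : dotv v x = b by move: xH; rewrite vH'.
  have vy : dotv v y = b' by move: yH; rewrite vH''.
  exists v; split=> z zX zp.
    rewrite vx lt_neqAle (only _ _ _ _ _ Hx vH') //.
    by apply: supporting_side sH' vH' yX zX _; rewrite vy.
  rewrite vy lt_neqAle eq_sym (only _ _ _ _ _ Hy vH'') //= -lerN2 -dotNv.
  rewrite hypN in vH''; apply: supporting_side sH'' vH'' xX zX _.
  by rewrite dotNv vx ltrN2.
have [lt_c|lt_c|eq_c] := ltgtP c c'.
- by apply: (main (- w) (- c) (- c')); rewrite -?hypN // ltrN2.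
- exact: main H'E H''E lt_c.
- by case: HH; rewrite H'E H''E eq_c.
Qed.

Lemma strictly_antipodal_sym X x y : strictly_antipodal X x y -> strictly_antipodal X y x.
Proof.
move=> /strictly_antipodalP[xX yX xy [u [ux uy]]].
apply/strictly_antipodalP; split=> //; first exact: nesym.
by exists (- u); split=> z zX zp; rewrite !dotNv ltrN2; [apply: uy|apply: ux].
Qed.

Lemma fset2_eq (T : choiceType) (a b c e : T) :
  [fset a; b]%fset = [fset c; e]%fset -> (a = c /\ b = e) \/ (a = e /\ b = c).
Proof.
move=> /fsetP h.
have := h a; have := h b; have := h c; have := h e.
rewrite !in_fset2 !eqxx ?orbT /=.
do ![case: eqP => ? /=]; subst; try (by []); try (by left); try (by right).
Qed.

Lemma card_antipodal (I : finType) (x : I -> V) X : injective x ->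
  (forall v, reflect (exists i, v = x i) (v \in X)) ->
  (2 * sa X = #|[set p : I * I | `[< strictly_antipodal X (x p.1) (x p.2) >] ]%SET|)%N.
Proof.
move=> x_inj xX.
set S := [set p | _]%SET.
have Ssym p : (p \in S) = ((p.2, p.1) \in S).
  have sym q : q \in S -> (q.2, q.1) \in S.
    by rewrite inE => /asboolP /strictly_antipodal_sym h; rewrite inE; apply/asboolP.
  by apply/idP/idP => [/sym//|/sym]; case: p.
have Sneq p : p \in S -> p.1 != p.2.
  by rewrite inE => /asboolP[_ _ h _]; apply/eqP => e; apply: h; rewrite e.
(* An arbitrary total order on [I] selects one orientation of each unordered pair; [S2] is the
   mirror image of [S1]. *)
pose lt (p : I * I) := (enum_rank p.1 < enum_rank p.2)%N.
pose S1 := [set p in S | lt p]%SET; pose S2 := [set (p.2, p.1) | p in S1]%SET.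
have cS2 : #|S2| = #|S1| by rewrite card_imset // => -[a b] [c e] [-> ->].
have S1E p : (p \in S1) = (p \in S) && lt p by rewrite inE.
have SE : S = (S1 :|: S2)%SET.
  apply/finset.setP => -[i j]; rewrite finset.in_setU.
  have -> : ((i, j) \in S2) = ((j, i) \in S1).
    apply/imsetP/idP => [[[a b] abS [-> ->]]//|jiS]; by exists (j, i).
  have := Ssym (i, j); rewrite !S1E /= => <-; rewrite -andb_orr /lt /=.
  have [ijS|//] := boolP ((i, j) \in S); have := Sneq _ ijS.
  rewrite -neq_ltn => ij /=; apply/esym.
  by apply: contra ij => /eqP/ord_inj/enum_rank_inj ->.
have dS : [disjoint S1 & S2].
  apply/pred0P => -[i j] /=; apply/negbTE/negP => /andP[].
  rewrite S1E => /andP[_ /= ij] /imsetP[[a b]]; rewrite S1E => /andP[_ ab] [ia jb].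
  by move: ij ab; rewrite ia jb /lt /=; lia.
have -> : #|S| = (2 * #|S1|)%N.
  by rewrite SE; have /eqP -> : #|S1 :|: S2|%SET == (#|S1| + #|S2|)%N;
     [rewrite (leq_card_setU _ _).2 | rewrite cS2; lia].
congr (2 * _)%N.
pose m (p : I * I) := [fset x p.1; x p.2]%fset.
have m_inj : {in S1 &, injective m}.
  move=> [i j] [k l]; rewrite !S1E /lt /= => /andP[_ ij] /andP[_ kl] /fset2_eq /=.
  case=> -[/x_inj ? /x_inj ?]; subst; first by [].
  by move: ij kl; lia.
rewrite /sa (_ : [fset e in _ | _]%fset = [fset m p | p in S1]%fset).
  by rewrite card_in_imfset //= cardE.
apply/fsetP => e; rewrite !inE /=; apply/andP/imfsetP => [[eX]|[p pS ->]].
  move=> /asboolP[v [w [eE vw]]]; have [vX wX _ _] := vw.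
  have [i vi] := xX _ vX; have [j wj] := xX _ wX; subst v w.
  have ijS : (i, j) \in S by rewrite inE; apply/asboolP.
  have := ijS; rewrite {1}SE finset.in_setU => /orP[ijS1|]; first by exists (i, j).
  case/imsetP => -[k l] klS [ik jl]; exists (k, l) => //.
  by rewrite eE ik jl /m /= fsetUC.
have pS' : p \in S by move: pS; rewrite S1E => /andP[].
move: pS'; rewrite inE => /asboolP pS'; have [p1 p2 _ _] := pS'; split.
  by rewrite fpowersetE; apply/fsubsetP => z /fset2P[] ->.
by apply/asboolP; exists (x p.1), (x p.2).
Qed.

Lemma lower_bound n X : Cs n X -> (1 < n)%N ->
  (d.+1 * d <= 2 * sa X + (n - d.+1) * (n - d.+1).+1)%N.
Proof.
move=> [cX affX scp] n_gt1.
have szX : size (enum_fset X) = n by [].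
pose x (i : 'I_n) : V := nth 0 (enum_fset X) i.
have x_inj : injective x.
  move=> i j /eqP; rewrite nth_uniq ?szX ?fset_uniq // => /eqP; exact: val_inj.
have xP v : reflect (exists i, v = x i) (v \in X).
  apply: (iffP idP) => [vX|[i ->]]; last by apply: mem_nth; rewrite szX.
  have lt_v : (index v (enum_fset X) < n)%N by rewrite -szX index_mem.
  by exists (Ordinal lt_v); rewrite /x nth_index.
rewrite (card_antipodal x_inj xP).
(* Columns are the points extended by 1, so a row (u, c) times [M] lists the values of the affine
   functional u . x + c on [X]. *)
pose M : 'M[R]_(d + 1, n) := col_mx (\matrix_(k, i) x i 0 k) (const_mx 1).
have ME u c i : (row_mx u (const_mx c) *m M) 0 i = dotv u (x i) + c.
  rewrite mul_row_col !mxE big_ord1 !mxE mulr1; congr (_ + _).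
  by apply: eq_bigr => k _; rewrite mxE.
(* An affine functional vanishing on [X] vanishes on its affine hull, the whole space, so the rows
   are independent. *)
have rM : \rank M = d.+1.
  suff /eqP -> : row_free M by rewrite addn1.
  rewrite -kermx_eq0.
  apply/eqP/row_matrixP => j; rewrite row0.
  have : row j (kermx M) *m M = 0 by apply/sub_kermxP; rewrite row_sub.
  set r := row _ _; rewrite -[r]hsubmxK; set u := lsubmx r.
  have -> : rsubmx r = const_mx (rsubmx r 0 0).
    by apply/matrixP => k l; rewrite !ord1 [RHS]mxE.
  set c := rsubmx r 0 0 => /matrixP uc.
  have h v : dotv u v = - c.
    have : aff_hull [set` X]%classic v by rewrite affX.
    apply: (@smallest_sub _ _ _ (hyperplane u (- c))) => [y z t|y /xP[i ->]].
      by rewrite /hyperplane /= dotvD !dotvZ => -> ->; ring.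
    by have := uc 0 i; rewrite ME mxE /hyperplane /= => /eqP; rewrite addr_eq0 => /eqP.
  have c0 : c = 0.
    by have /esym/eqP := h 0; rewrite dotv0 oppr_eq0 => /eqP.
  rewrite c0; have -> : u = 0.
    apply/rowP => k; have := h (delta_mx 0 k).
    rewrite c0 oppr0 /dotv (bigD1 k) //= big1 ?addr0 => [|l /negPf lk].
      by rewrite [delta_mx _ _ _ _]mxE !eqxx mulr1 => ->; rewrite mxE.
    by rewrite [delta_mx _ _ _ _]mxE lk andbF mulr0.
  by apply/matrixP => k l; rewrite !mxE; case: split => ?; rewrite !mxE.
have MP (f : 'rV[R]_n) : (f <= <<M>>)%MS -> exists u, exists c, forall i, f 0 i = dotv u (x i) + c.
  rewrite genmxE => /submxP[r ->]; exists (lsubmx r), (rsubmx r 0 0) => i.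
  rewrite -ME; congr ((_ *m _) 0 i); rewrite -[LHS]hsubmxK; congr row_mx.
  by apply/matrixP => k l; rewrite !ord1 [RHS]mxE.
have MW u c : (row_mx u (const_mx c) *m M <= <<M>>)%MS by rewrite genmxE submxMl.
have cfg : config [set: 'I_n]%SET <<M>>%MS.
  split.
  - have -> : (const_mx 1 : 'rV[R]_n) = row_mx (0 : V) (const_mx 1) *m M.
      by apply/rowP => i; rewrite ME dot0v add0r mxE.
    exact: MW.
  - by move=> f _ f0; apply/rowP => i; rewrite f0 ?mxE ?finset.in_setT.
  - move=> i _; have xi : x i \in X by apply/xP; exists i.
    have [u hu] := vertex_strict scp xi.
    exists (row_mx u (const_mx 0) *m M); first exact: MW.
    apply: set1_argmax => [|z _ zi]; first by rewrite finset.in_setT.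
    rewrite !ME !addr0 hu //; first by apply/xP; exists z.
    by rewrite (inj_eq x_inj).
have := antipodal_bound cfg; rewrite mxrank_gen rM cardsT card_ord /=.
move=> /leq_trans; apply; rewrite leq_add2r; apply: subset_leq_card.
apply/fintype.subsetP => -[i j]; rewrite inE => /asboolP[f [fW fi fj]]; rewrite inE /=.
have [u [c fE]] := MP f fW.
have ui z : z \in X -> z != x i -> dotv u z < dotv u (x i).
  move=> /xP[k ->] ki.
  have := argmax_set1 fi (finset.in_setT k); rewrite !fE ltrD2r; apply.
  by apply: contra ki => /eqP ->.
have uj z : z \in X -> z != x j -> dotv u (x j) < dotv u z.
  move=> /xP[k ->] kj.
  have := argmax_set1 fj (finset.in_setT k); rewrite !mxE !fE ltrN2 ltrD2r; apply.
  by apply: contra kj => /eqP ->.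
apply/asboolP/strictly_antipodalP; split; last by exists u.
- by apply/xP; exists i.
- by apply/xP; exists j.
move=> /x_inj ij; subst j.
have [k ki] : exists k, k \in [set~ i]%SET.
  by apply/card_gt0P; rewrite cardsC1 card_ord; case: (n) n_gt1 => [|[]].
rewrite !inE in ki; have xk : x k \in X by apply/xP; exists k.
have xki : x k != x i by rewrite (inj_eq x_inj).
by have := lt_trans (ui _ xk xki) (uj _ xk xki); rewrite ltxx.
Qed.

(** An affine set through 0 is a linear subspace: a sum is twice a midpoint. *)
Lemma affine_set_full (B : set V) : affine_set B -> B 0 ->
  (forall i, B (delta_mx 0 i)) -> forall v, B v.
Proof.
move=> aB B0 Be.
have BZ t v : B v -> B (t *: v).
  by move=> Bv; have := aB v 0 t Bv B0; rewrite scaler0 addr0.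
have BD v w : B v -> B w -> B (v + w).
  move=> Bv Bw; have := BZ 2 _ (aB v w 2^-1 Bv Bw).
  rewrite scalerDr !scalerA mulfV ?pnatr_eq0 // scale1r.
  have -> : 2 * (1 - 2^-1) = 1 :> R by lra.
  by rewrite scale1r.
move=> v; rewrite [v]row_sum_delta; elim/big_ind: _ => // i _; exact/BZ/Be.
Qed.

Lemma Cs_family (I : finType) (x u : I -> V) :
  (forall i j, j != i -> dotv (u i) (x j) < dotv (u i) (x i)) -> (0 < #|I|)%N ->
  (forall B : set V, affine_set B -> (forall i, B (x i)) -> forall v, B v) ->
  Cs #|I| [fset x i | i in I]%fset /\ injective x.
Proof.
move=> hu I0 full.
have x_inj : injective x.
  move=> i j ij; apply/eqP/contraT => /(hu j); by rewrite ij ltxx.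
split=> //; split.
- by rewrite card_imfset //= -cardE.
- apply/seteqP; split=> // v _ B [aB sB]; apply: full => // i.
  by apply: sB; apply/imfsetP; exists i.
- apply: strict_convex_position.
    by have /card_gt0P[i _] := I0; apply/fset0Pn; exists (x i); apply/imfsetP; exists i.
  move=> _ /imfsetP[i _ ->]; exists (u i) => _ /imfsetP[j _ ->] ji.
  by apply: hu; apply: contra ji => /eqP ->.
Qed.

End Geometry.

(** * Constructions *)

Lemma card_offdiag (T : finType) :
  (#|[set p : T * T | p.1 != p.2]%SET| + #|T| = #|T| * #|T|)%N.
Proof.
rewrite -card_prod -(cardsC [set p : T * T | p.1 != p.2]%SET); congr (_ + _)%N.
rewrite -cardsT -(card_imset (f := fun t : T => (t, t))); last by move=> ? ? [].
apply: eq_card => -[a b]; rewrite finset.in_setC inE negbK /=.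
by apply/imsetP/eqP => [[t _ [-> ->]]//|<-]; exists a.
Qed.

Section Constructions.
Variables (R : realType) (d : nat).
Local Notation V := 'rV[R]_d.
Local Notation "''e_' i" := (delta_mx 0 i : V) (at level 8, i at level 2).

Lemma dot_delta i (v : V) : dotv 'e_i v = v 0 i.
Proof.
rewrite /dotv (bigD1 i) //= big1 ?addr0 => [|l /negPf li].
  by rewrite mxE !eqxx mul1r.
by rewrite [delta_mx _ _ _ _]mxE li andbF mul0r.
Qed.

Lemma dotC (u v : V) : dotv u v = dotv v u.
Proof. by apply: eq_bigr => i _; rewrite mulrC. Qed.

Lemma family_antipodalP (I : finType) (x : I -> V) i j :
  strictly_antipodal [fset x i | i in I]%fset (x i) (x j) -> injective x ->
  i != j /\ exists u, forall k, (k != i -> dotv u (x k) < dotv u (x i)) /\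
                                (k != j -> dotv u (x j) < dotv u (x k)).
Proof.
move=> /strictly_antipodalP[_ _ ij [u [ui uj]]] x_inj; split.
  by apply/eqP => ij'; apply: ij; rewrite ij'.
have xX k : x k \in [fset x i | i in I]%fset by apply/imfsetP; exists k.
exists u => k; split=> [ki|kj]; [apply: ui|apply: uj] => //.
  by rewrite (inj_eq x_inj).
by rewrite (inj_eq x_inj).
Qed.

Lemma card_family (I : finType) (x : I -> V) : injective x ->
  (2 * sa [fset x i | i in I]%fset =
   #|[set p : I * I | `[< strictly_antipodal [fset x i | i in I]%fset (x p.1) (x p.2) >] ]%SET|)%N.
Proof.
move=> x_inj; apply: card_antipodal => // v.
by apply: (iffP (imfsetP _ _ _ _)) => -[i]; [exists i | exists i].
Qed.

(** * Construction for large k: part of a cross-polytope *)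

Section Crosspolytope.
Variable k : nat.
Hypotheses (k_gt0 : (0 < k)%N) (kd : (k <= d)%N).

Let I : finType := ('I_d + 'I_k)%type.
Let base (a : I) : 'I_d := match a with inl i => i | inr j => widen_ord kd j end.
Let x (a : I) : V := match a with inl i => 'e_i | inr j => - 'e_(widen_ord kd j) end.

(** If -a and -b are also points and -a differs from b, then a and b are not antipodal: a maximum at
    a forces u . (a + b) > 0, a minimum at b forces u . (a + b) < 0. This excludes 4 k (k - 1)
    ordered pairs besides the diagonal. *)
Lemma crosspolytope : exists2 X : {fset V}, Cs (d + k) X &
  (2 * sa X + 4 * k * k.-1 + (d + k) <= (d + k) * (d + k))%N.
Proof.
have cI : #|{: I}| = (d + k)%N by rewrite card_sum !card_ord.
have dE i j : ('e_i : V) 0 j = (i == j)%:R by rewrite mxE eqxx eq_sym.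
have [||B aB xB|cX x_inj] := @Cs_family R d I x x.
- have lt01 (b : bool) : - b%:R < 1 :> R by case: b; rewrite ?oppr0 ?ltr01 ?ltrN10 //; lra.
  have oE (v : V) j : (- v) 0 j = - v 0 j by rewrite mxE.
  case=> i [j|j] ij /=.
  + rewrite !dot_delta !dE eqxx (_ : j == i = false) ?ltr01 //.
    by apply: contraNF ij => /eqP ->.
  + by rewrite !dot_delta oE !dE eqxx.
  + by rewrite !dotNv !dot_delta oE !dE eqxx opprK.
  + rewrite !dotNv !dot_delta !oE !dE eqxx !opprK (_ : _ == _ = false) ?ltr01 //.
    by apply: contraNF ij => /eqP /(congr1 val) /= /val_inj ->.
- by rewrite cI addn_gt0 k_gt0 orbT.
- apply: affine_set_full => //; last by move=> i; exact: xB (inl i).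
  pose j := widen_ord kd (Ordinal k_gt0).
  have -> : 0 = 2^-1 *: x (inl j) + (1 - 2^-1) *: x (inr (Ordinal k_gt0)) :> V.
    by rewrite /= scalerN -scalerBl (_ : _ - _ = 0) ?scale0r //; lra.
  exact: aB.
exists [fset x i | i in I]%fset; first by rewrite -cI.
rewrite (card_family x_inj); set S := [set p | _]%SET.
pose low (a : I) := (base a < k)%N.
pose Bd := [set p : I * I | [&& low p.1, low p.2 & base p.1 != base p.2]]%SET.
pose Di := [set p : I * I | p.1 == p.2]%SET.
have opp a : low a -> exists2 a', x a' = - x a & base a' = base a.
  case: a => [i li|j _]; last by exists (inl (widen_ord kd j)); rewrite //= opprK.
  by exists (inr (Ordinal li)); rewrite /= (_ : widen_ord _ _ = i) //; exact: val_inj.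
have dSB : [disjoint S & Bd].
  apply/pred0P => -[a b] /=; apply/negbTE/negP => /andP[].
  rewrite inE => /asboolP /family_antipodalP /(_ x_inj)[_ [u hu]].
  rewrite inE /= => /and3P[/opp[a' xa' ba'] /opp[b' xb' bb'] ab].
  have [_ ha] := hu a'; have [hb _] := hu b'.
  have /ha : a' != b by apply: contraNneq ab => <-; rewrite ba'.
  have /hb : b' != a by apply: contraNneq ab => <-; rewrite bb'.
  by rewrite xa' xb' !(dotC u) !dotNv; lra.
have dSD : [disjoint S & Di].
  apply/pred0P => -[a b] /=; apply/negbTE/negP => /andP[].
  rewrite inE => /asboolP /family_antipodalP /(_ x_inj)[ab _].
  by rewrite inE /= (negPf ab).
have dBD : [disjoint Bd & Di].
  apply/pred0P => -[a b] /=; apply/negbTE/negP => /andP[].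
  by rewrite inE /= => /and3P[_ _ ab]; rewrite inE /= => /eqP ab'; rewrite ab' eqxx in ab.
have sub (P : {set I * I}) : P \subset finset.setT by apply/fintype.subsetP => ?; rewrite finset.in_setT.
have := leq_card_disjoint3 (sub S) (sub Bd) (sub Di) dSB dSD dBD.
rewrite cardsT card_prod cI => h; apply: leq_trans h; apply: leq_add.
  rewrite leq_add2l.
  pose c (p : bool * 'I_k) : I := if p.1 then inl (widen_ord kd p.2) else inr p.2.
  have c_inj : injective c.
    move=> [[] i] [[] j] //= [].
      by move=> ij; congr (_, _); exact/val_inj/ij.
    by move=> ->.
  have bc p : base (c p) = widen_ord kd p.2 by case: p => -[].
  pose cc (p : (bool * bool) * ('I_k * 'I_k)) := (c (p.1.1, p.2.1), c (p.1.2, p.2.2)).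
  have cc_inj : injective cc.
    by move=> [[s t] [i j]] [[s' t'] [i' j']] [/c_inj[-> ->] /c_inj[-> ->]].
  pose E := finset.setX (finset.setTfor (bool * bool)%type) [set p : 'I_k * 'I_k | p.1 != p.2]%SET.
  have -> : (4 * k * k.-1 = #|E|)%N.
    rewrite cardsX cardsT card_prod card_bool; have := card_offdiag 'I_k.
    rewrite card_ord; case: (k) => [|m]; first by rewrite !muln0 addn0 => ->; rewrite muln0.
    by move=> hm; rewrite -mulnA; congr (_ * _)%N; apply/(@addIn m.+1); rewrite hm mulnS addnC.
  rewrite -(card_imset (mem E) cc_inj); apply: subset_leq_card.
  apply/fintype.subsetP => _ /imsetP[[[s t] [i j]] ijE ->]; move: ijE.
  rewrite finset.in_setX => /andP[_]; rewrite inE /= => ij.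
  rewrite inE /low /cc /= !bc /= !ltn_ord /=; apply: contra ij => /eqP /(congr1 val) /= ij.
  exact/eqP/val_inj.
rewrite -cI -cardsT -(card_imset (f := fun a : I => (a, a))); last by move=> ? ? [].
by apply: subset_leq_card; apply/fintype.subsetP => _ /imsetP[a _ ->]; rewrite inE /= eqxx.
Qed.
End Crosspolytope.

(** * Construction for small k: a simplex with points beyond one facet *)

Section Cluster.
Variable m : nat.
Hypotheses (d_ge3 : (3 <= d)%N) (md : (m <= d)%N).

Let I : finType := (option 'I_d + 'I_m)%type.
Let w : 'I_m -> 'I_d := widen_ord md.
(** The barycenter of the facet of the unit vectors, shifted by e_i / d; its coordinate sum is 1 + 1
    / d. *)
Let z (i : 'I_d) : V := d%:R^-1 *: (const_mx 1 + 'e_i).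
Let x (a : I) : V :=
  match a with inl None => 0 | inl (Some i) => 'e_i | inr s => z (w s) end.
Let u (a : I) : V :=
  match a with
  | inl None => - const_mx 1
  | inl (Some i) => 'e_i
  (* Its value is d + 1 / d at [z (w s)] and at most d at every other point. *)
  | inr s => (d%:R - 1) *: const_mx 1 + 'e_(w s)
  end.

Lemma cluster_dim : 3 <= d%:R :> R. Proof. by rewrite ler_nat. Qed.

Lemma dot_const (v : V) : dotv v (const_mx 1) = \sum_i v 0 i.
Proof. by apply: eq_bigr => i _; rewrite mxE mulr1. Qed.

Lemma dot_cluster (v : V) i : d%:R * dotv v (z i) = \sum_j v 0 j + v 0 i.
Proof.
have d3 := cluster_dim.
by rewrite dotvZ dotvD dot_const dotC dot_delta mulrA mulfV ?mul1r // gt_eqF //; lra.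
Qed.

Lemma cluster : exists2 X : {fset V}, Cs (d.+1 + m) X &
  (2 * sa X <= d.+1 * d + 2 * m)%N.
Proof.
have d3 := cluster_dim.
have cI : #|{: I}| = (d.+1 + m)%N by rewrite card_sum card_option !card_ord.
have dE i j : ('e_i : V) 0 j = (i == j)%:R by rewrite mxE eqxx eq_sym.
have zE i j : z i 0 j = d%:R^-1 * (1 + (i == j)%:R) by rewrite -dE !mxE.
have bool_le (b : bool) : 0 <= b%:R :> R /\ b%:R <= 1 :> R by case: b; rewrite ?ler01 ?lexx.
have sum1 : \sum_(j < d) (1 : R) = d%:R by rewrite sumr_const card_ord.
have sumd i : \sum_j ('e_i : V) 0 j = 1.
  rewrite (bigD1 i) //= big1 ?addr0 ?dE ?eqxx // => j /negPf ji.
  by rewrite dE eq_sym ji.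
have inj_w : injective w by move=> s t /(congr1 val) /= /val_inj.
have [||B aB xB|cX x_inj] := @Cs_family R d I x u.
- have dz v i : dotv v (z i) = (\sum_j v 0 j + v 0 i) / d%:R.
    by rewrite -dot_cluster mulrAC mulfV ?mul1r // gt_eqF //; lra.
  have sumU i : \sum_j ((d%:R - 1) *: const_mx 1 + 'e_i : V) 0 j = (d%:R - 1) * d%:R + 1.
    rewrite (eq_bigr (fun j => (d%:R - 1) * 1 + ('e_i : V) 0 j)) => [|j _].
      by rewrite big_split /= -mulr_sumr sum1 sumd.
    by rewrite !mxE.
  have uE i j : ((d%:R - 1) *: const_mx 1 + 'e_i : V) 0 j = d%:R - 1 + (i == j)%:R.
    by rewrite -dE !mxE mulr1.
  case=> [[i|]|s] [[j|]|t] // ab; rewrite /= ?dotv0 ?dotNv.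
  + rewrite !dot_delta !dE eqxx (_ : j == i = false) ?ltr01 //.
    by apply: contraNF ab => /eqP ->.
  + by rewrite dot_delta dE eqxx ltr01.
  + rewrite !dot_delta zE dE eqxx mulrC ltr_pdivrMr; last by lra.
    by have [b0 b1] := bool_le (w t == i); rewrite /= mul1r; lra.
  + by rewrite dotC dot_const sumd oppr_lt0 ltr01.
  + rewrite dotC dot_const oppr_lt0 (_ : \sum_i _ = (d%:R + 1) / d%:R); last first.
      rewrite (eq_bigr (fun j => (1 + ('e_(w t) : V) 0 j) / d%:R)) => [|j _].
        by rewrite -mulr_suml big_split /= sum1 sumd.
      by rewrite zE dE mulrC.
    by rewrite divr_gt0 //; lra.
  + rewrite dz sumU uE eqxx dotC dot_delta uE ltr_pdivlMr; last by lra.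
    by have [b0 b1] := bool_le (w s == j); rewrite /=; nra.
  + rewrite dz sumU uE eqxx divr_gt0 //=; nra.
  + rewrite !dz !sumU !uE eqxx ltr_pM2r ?invr_gt0; last by lra.
    rewrite (_ : w s == w t = false) /=; first by lra.
    by apply: contraNF ab => /eqP /inj_w ->.
- by rewrite cI.
- by apply: affine_set_full => //; [exact: xB (inl None) | move=> i; exact: xB (inl (Some i))].
exists [fset x i | i in I]%fset; first by rewrite -cI.
(* If v is maximal at [z (w s)] with value M and minimal at e_j, then v_j < 0 and all v_i < M, so d
   M = \sum_i v_i + v_(w s) < d M. *)
have zj s j : ~ strictly_antipodal [fset x i | i in I]%fset (x (inr s)) (x (inl (Some j))).
  move=> /family_antipodalP /(_ x_inj)[_ [v hv]].
  have vj i : dotv v 'e_i = v 0 i by rewrite dotC dot_delta.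
  have [M0 _] := hv (inl None); have [_ m0] := hv (inl None).
  have {M0} M0 := M0 isT; have {m0} m0 := m0 isT.
  rewrite /= dotv0 in M0; rewrite /= dotv0 vj in m0.
  have := dot_cluster v (w s); rewrite /= in M0; set M := dotv v (z (w s)) in M0 *.
  have Mi i : v 0 i < M by have [/(_ isT)] := hv (inl (Some i)); rewrite /= vj.
  have le_sum : \sum_(i < d | i != j) v 0 i <= (d%:R - 1) * M.
    apply: (@le_trans _ _ (\sum_(i < d | i != j) M)); first by apply: ler_sum => i _; exact/ltW.
    rewrite sumr_const cardC1 card_ord -[_ *+ _]mulr_natl -subn1 natrB //.
    by apply: leq_trans d_ge3.
  rewrite (bigD1 j) //=; have := Mi (w s); lra.
(* Let D > 0 be the difference of v at the two points. Then d D = v_(w s) - v_(w t), which is less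
   than D by comparison with the two unit vectors. *)
have zz s t : ~ strictly_antipodal [fset x i | i in I]%fset (x (inr s)) (x (inr t)).
  move=> /family_antipodalP /(_ x_inj)[st [v hv]].
  have vj i : dotv v 'e_i = v 0 i by rewrite dotC dot_delta.
  have [+ _] := hv (inl (Some (w s))) => /(_ isT); rewrite /= vj.
  have [_ +] := hv (inl (Some (w t))) => /(_ isT); rewrite /= vj.
  have := dot_cluster v (w s); have := dot_cluster v (w t).
  have [_ +] := hv (inr s) => /(_ st); rewrite /=.
  by move: (dotv v _) (dotv v _) (\sum_j _) => a b c; nra.
rewrite (card_family x_inj); set S := [set p | _]%SET.
pose S1 := [set (inl p.1, inl p.2) | p in [set p : option 'I_d * option 'I_d | p.1 != p.2]]%SET : {set I * I}.
pose S2 := [set (inl None, inr s) | s in 'I_m]%SET : {set I * I}.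
pose S3 := [set (inr s, inl None) | s in 'I_m]%SET : {set I * I}.
have : S \subset S1 :|: S2 :|: S3.
  apply/fintype.subsetP => -[a b]; rewrite inE => /asboolP ab; rewrite !finset.in_setU.
  move: ab; case: a b => [i|s] [j|t] /= ab.
  - apply/orP; left; apply/orP; left; apply/imsetP; exists (i, j) => //.
    by rewrite inE /=; have [+ _] := @family_antipodalP I x (inl i) (inl j) ab x_inj; apply: contra => /eqP ->.
  - case: i ab => [i|] ab; first by case: (@zj t i); exact: strictly_antipodal_sym.
    by apply/orP; left; apply/orP; right; apply/imsetP; exists t.
  - case: j ab => [j|] ab; first by case: (@zj s j).
    by apply/orP; right; apply/imsetP; exists s.
  - by case: (@zz s t).
move=> /subset_leq_card /leq_trans; apply.
apply: leq_trans (leq_card_setU _ _) _.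
rewrite mul2n -addnn addnA; apply: leq_add; last first.
  by apply: leq_trans (leq_imset_card _ _) _; rewrite card_ord.
apply: leq_trans (leq_card_setU _ _) _; apply: leq_add; last first.
  by apply: leq_trans (leq_imset_card _ _) _; rewrite card_ord.
apply: leq_trans (leq_imset_card _ _) _.
have := card_offdiag (option 'I_d); rewrite card_option card_ord => h.
by rewrite -(leq_add2r d.+1) h mulnS addnC.
Qed.
End Cluster.

End Constructions.

(** * The estimates *)

Section Estimates.
Variable R : realType.
Implicit Types d k : nat.

(** A member of [Cs n] makes the set of minima inhabited, so [xget] does not return its default. *)
Lemma sa_minP d n (X : {fset 'rV[R]_d}) : Cs n X ->
  (exists2 Y : {fset 'rV[R]_d}, Cs n Y & sa Y = sa_min R d n) /\ (sa_min R d n <= sa X)%N.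
Proof.
move=> CX; rewrite /sa_min; set P := [set m | _]%classic.
have [m Pm] : exists m, P m.
  pose Q m := `[< exists2 Y : {fset 'rV[R]_d}, Cs n Y & sa Y = m >].
  have exQ : exists m, Q m by exists (sa X); apply/asboolP; exists X.
  case: (ex_minnP exQ) => m /asboolP Qm minm; exists m; split=> // Y CY.
  by apply: minm; apply/asboolP; exists Y.
by have [Y minY] := xgetPex 0%N (ex_intro P m Pm); split=> //; exact: minY.
Qed.

Lemma dim_bounds d k : (2 <= k <= d - 1)%N ->
  [/\ 2 <= k%:R :> R, k%:R + 1 <= d%:R :> R & (k < d)%N].
Proof.
move=> /andP[k2 kd]; have lt_kd : (k < d)%N by lia.
by split=> //; rewrite ?natr1 ler_nat.
Qed.

(** 2 L - U equals d (d + 1) / 2 - k^2 + 1 for small k and d + (d - k) (d - k + 1) / 2 for large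
    k. *)
Lemma U_est_le d k : (2 <= k <= d - 1)%N -> U_est R d k <= 2 * L_est R d k.
Proof.
move=> hk; have [k2 kd _] := dim_bounds hk; rewrite /U_est /L_est.
case: leqP => [le_k|_]; last by nra.
have : (3 * k + 2 <= 2 * d)%N by lia.
rewrite -(ler_nat R) natrD !natrM => le_kd; nra.
Qed.

Lemma L_est_gt0 d k : (2 <= k <= d - 1)%N -> 0 < L_est R d k.
Proof. by move=> hk; have [k2 kd _] := dim_bounds hk; rewrite /L_est; nra. Qed.

Lemma sa_min_bounds d k : (2 <= k <= d - 1)%N ->
  L_est R d k <= (sa_min R d (d + k))%:R <= U_est R d k.
Proof.
move=> hk; have [k2 kd lt_kd] := dim_bounds hk.
have k0 : (0 < k)%N by lia.
have [X CX saX] : exists2 X : {fset 'rV[R]_d}, Cs (d + k) X & (sa X)%:R <= U_est R d k.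
  rewrite /U_est; case: leqP => [_|_].
    (* The simplex already has d + 1 points, so k - 1 are added. *)
    have [| |X CX] := @cluster R d k.-1; [by lia|by lia|].
    rewrite (_ : (d.+1 + k.-1 = d + k)%N) in CX; last by lia.
    move=> h; exists X => //.
    have {h} : (2 * sa X + 2 <= d * d + d + 2 * k)%N by lia.
    by rewrite -(ler_nat R) !natrD !natrM => h; lra.
  have [X CX h] := crosspolytope R k0 (ltnW lt_kd); exists X => //.
  have {h} : (2 * sa X + 4 * k * k + (d + k) <= (d + k) * (d + k) + 4 * k)%N.
    by case: (k) k0 h => // k' _; rewrite /= mulnS; lia.
  rewrite -(ler_nat R) !natrD !natrM !natrD => h; lra.
have [[Y CY saY] le_X] := sa_minP CX; apply/andP; split; last first.
  by apply: le_trans saX; rewrite ler_nat.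
rewrite -saY.
have := lower_bound CY; have -> : (d + k - d.+1 = k.-1)%N by lia.
rewrite prednK // => /(_ ltac:(lia)) h.
have {h} : (d * d + d + k <= 2 * sa Y + k * k)%N.
  by case: (k) k0 h => // k' _; rewrite /= => h; lia.
rewrite -(ler_nat R) !natrD !natrM /L_est => h; lra.
Qed.

Lemma ratio_sharp (c : R) :
  (forall d k : nat, (2 <= k <= d - 1)%N -> U_est R d k / L_est R d k <= c) -> 2 <= c.
Proof.
move=> h; rewrite leNgt; apply/negP => c_lt2.
pose e := 2 - c; have e0 : 0 < e by rewrite subr_gt0.
(* Along [d = t ^ 2] and [k = t ^ 2 - t] the ratio is [2 - (3 t + 1) / ((2 t - 1) (t + 1))]. *)
pose t := (Num.truncn (2 / e)).+4.
have t4 : 4 <= t%:R :> R by rewrite ler_nat.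
have te : 2 < t%:R * e.
  rewrite -ltr_pdivrMr //; apply: lt_le_trans (truncnS_gt _) _.
  by rewrite ler_nat; do 3!apply: leqW.
have tt : (4 <= t)%N by [].
have hk : (2 <= t * t - t <= t * t - 1)%N by nia.
have := h _ _ hk; rewrite ler_pdivrMr ?L_est_gt0 // /U_est /L_est.
case: leqP => [le_k|_]; first by nia.
rewrite natrB ?natrM; last by nia.
move: te t4; rewrite /e; set T := t%:R => te t4 hU.
(* This says 3 T + 1 < e (2 T - 1) (T + 1) for e = 2 - c; as T e > 2, the right side exceeds 4 T -
   2. *)
have : c * (2 * T - 1) * (T + 1) < 2 * (2 * T - 1) * (T + 1) - (3 * T + 1) by nra.
nra.
Qed.

End Estimates.

Theorem proposition2p20 (R : realType) :
  [/\ exists c1 c2 : R, [/\ 0 < c1, 0 < c2 &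
        forall d k : nat, (2 <= k <= d - 1)%N ->
          c1 * ((d%:R - k%:R) * d%:R) <= (sa_min R d (d + k))%:R
            <= c2 * ((d%:R - k%:R) * d%:R)],
      forall d k : nat, (2 <= k <= d - 1)%N ->
        L_est R d k <= (sa_min R d (d + k))%:R <= U_est R d k,
      forall d k : nat, (2 <= k <= d - 1)%N ->
        U_est R d k / L_est R d k <= 2 &
      forall c : R,
        (forall d k : nat, (2 <= k <= d - 1)%N ->
          U_est R d k / L_est R d k <= c) -> 2 <= c].
Proof.
split; [|exact: sa_min_bounds| |exact: ratio_sharp].
  (* L is (d - k + 1) (d + k) / 2, hence at least (d - k) d / 2, and U <= 2 L = (d - k + 1) (d + k)
     is at most 2 (d - k) times 2 d. *)
  exists (1 / 2), 4; split; [by lra|by lra|] => d k hk.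
  have [k2 kd _] := dim_bounds R hk; have /andP[Ls sU] := sa_min_bounds R hk.
  apply/andP; split.
    by apply: le_trans Ls; rewrite /L_est; nra.
  by apply: (le_trans sU); apply: (le_trans (U_est_le R hk)); rewrite /L_est; nra.
by move=> d k hk; rewrite ler_pdivrMr ?L_est_gt0 // U_est_le.
Qed.
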